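(* Let $G$ be a connected unicyclic graph with odd girth $g$, and let $h$ be the maximum diameter among the induced trees of $G$ (the trees rooted at the vertices of the cycle of $G$). Let $\lambda_1(G)$ and $\lambda_n(G)$ be the largest and the smallest eigenvalue of $G$, respectively, and suppose that $$\lambda_n(G)\geq 1-\cos\frac{\pi}{D_0+1}-\lambda_1(G),\qquad\text{where } D_0=\frac{g+1}{2}+h.$$ Then $$S_{\mathcal{L}}(G)=q_1-q_n=S_Q(G)\geq S(G),$$ where $q_1\geq\cdots\geq q_n$ are the signless Laplacian eigenvalues of $G$.
   Context: Graphs are finite, simple and undirected. A connected unicyclic graph is a connected graph with exactly one cycle; its girth $g$ is the length of that cycle. The induced trees of such a $G$ are the trees rooted at the cycle vertices: for each vertex $v$ of the cycle $C$, the tree rooted at $v$ is the connected component containing $v$ of the graph obtained from $G$ by deleting all edges of $C$ (so $v$ itself belongs to the tree). The diameter of a connected graph is the maximum distance between two of its vertices. The eigenvalues of $G$ are those of its adjacency matrix $A(G)$; $S(G)=\lambda_1(G)-\lambda_n(G)$ where $n$ is the number of vertices. The signless Laplacian eigenvalues are the eigenvalues of $Q(G)=D(G)+A(G)$, with $D(G)$ the diagonal matrix of vertex degrees, and $S_Q(G)=q_1-q_n$. The line graph $\mathcal{L}(G)$ has the edges of $G$ as vertices, two being adjacent if the corresponding edges of $G$ share a common vertex. $S_{\mathcal{L}}(G)$ is the largest minus the smallest adjacency eigenvalue of $\mathcal{L}(G)$. *)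

(* Defs.v *)
From HB Require Import structures.
From mathcomp Require Import all_boot all_order all_algebra.

Set Implicit Arguments.
Unset Strict Implicit.
Unset Printing Implicit Defensive.

Import Order.TTheory GRing.Theory Num.Theory.

Local Open Scope ring_scope.

Record sgraph := SGraph {
  vertex :> finType;
  adj : rel vertex;
  adj_sym : symmetric adj;
  adj_irrefl : irreflexive adj }.

Section Graphs.
Variable G : sgraph.
Implicit Types (x y v : G) (c : seq G).

Definition connected_graph : Prop :=
  (0 < #|G|)%N /\ forall x y : G, connect (@adj G) x y.

Definition edges : {set {set G}} :=
  [set [set p.1; p.2] | p : G * G & adj p.1 p.2].

(* A cycle is given by a cyclic enumeration of its vertices; two enumerations
   describe the same cycle (up to starting point and orientation) exactly when
   they have the same edge set. *)
Definition is_cycle c : bool := ucycleb (@adj G) c && (2 < size c)%N.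

Definition cycle_edges c : {set {set G}} := [set [set x; next c x] | x in c].

Definition connected_unicyclic : Prop :=
  connected_graph /\
  exists! E : {set {set G}}, exists2 c, is_cycle c & E = cycle_edges c.

(* Length of a shortest walk from x to y; it is the dummy value #|G| when y is
   not reachable from x, so it is meaningful for connected graphs. *)
Definition dist x y : nat :=
  find (fun k => [exists p : k.-tuple G, path (@adj G) x p && (last x p == y)])
    (iota 0 #|G|).

Definition diam : nat := (\max_(x : G) \max_(y : G) dist x y)%N.

Definition del_edges_rel (E : {set {set G}}) : rel G :=
  fun x y => adj x y && ([set x; y] \notin E).

Lemma del_edges_sym E : symmetric (del_edges_rel E).
Proof. by move=> x y; rewrite /del_edges_rel adj_sym setUC. Qed.

Lemma del_edges_irrefl E : irreflexive (del_edges_rel E).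
Proof. by move=> x; rewrite /del_edges_rel adj_irrefl. Qed.

Definition del_edges E : sgraph :=
  SGraph (@del_edges_sym E) (@del_edges_irrefl E).

Definition component_type v := {x : G | connect (@adj G) v x}.

Definition component_rel v : rel (component_type v) :=
  fun u w => adj (val u) (val w).

Lemma component_sym v : symmetric (@component_rel v).
Proof. by move=> u w; rewrite /component_rel adj_sym. Qed.

Lemma component_irrefl v : irreflexive (@component_rel v).
Proof. by move=> u; rewrite /component_rel adj_irrefl. Qed.

Definition component v : sgraph :=
  SGraph (@component_sym v) (@component_irrefl v).

Definition line_type := {e : {set G} | e \in edges}.

Definition line_rel : rel line_type :=
  fun e f => (e != f) && ~~ [disjoint val e & val f].

Lemma line_sym : symmetric line_rel.
Proof. by move=> e f; rewrite /line_rel eq_sym disjoint_sym. Qed.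

Lemma line_irrefl : irreflexive line_rel.
Proof. by move=> e; rewrite /line_rel eqxx. Qed.

Definition line_graph : sgraph := SGraph line_sym line_irrefl.

Definition degree x : nat := #|[set y | adj x y]|.

End Graphs.

Definition induced_tree (G : sgraph) (c : seq G) (v : G) : sgraph :=
  @component (del_edges (cycle_edges c)) v.

Definition max_tree_diam (G : sgraph) (c : seq G) : nat :=
  (\max_(v <- c) diam (induced_tree c v))%N.

(* Loaded only here because the set notations of classical_sets shadow those of
   finset used above. *)
From mathcomp Require Import all_classical all_reals all_analysis.
From mathcomp Require Import spectral polyrcf complex.

Section Spectra.
Variable R : realType.

Definition adj_mx (G : sgraph) : 'M[R]_#|G| :=
  \matrix_(i, j) (adj (enum_val i) (enum_val j))%:R.

Definition deg_mx (G : sgraph) : 'M[R]_#|G| :=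
  diag_mx (\row_i (degree (enum_val i))%:R).

Definition signless_laplacian (G : sgraph) : 'M[R]_#|G| := deg_mx G + adj_mx G.

(* The supremum and infimum of the set of eigenvalues are attained for
   symmetric matrices of positive size; see eig_maxP and eig_minP. *)
Definition eig_max n (A : 'M[R]_n) : R := sup [set a | eigenvalue A a]%classic.

Definition eig_min n (A : 'M[R]_n) : R := inf [set a | eigenvalue A a]%classic.

Lemma sym_has_eigenvalue n (A : 'M[R]_n) :
  (0 < n)%N -> A^T = A -> exists a, eigenvalue A a.
Proof.
move=> n_gt0 symA.
pose f : {rmorphism R -> complex R} := real_complex_def (Phant R).
have f_conj x : Num.conj (f x) = f x by apply/conj_Creal/complex_realP; exists x.
pose B := map_mx f A.
have [a Ba] := eigenvalue_closed B n_gt0.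
have [v vB v0] := eigenvalueP Ba.
pose cj := (Num.conj : {rmorphism _ -> complex R}).
pose vc := (map_mx cj v)^T.
have Bc : map_mx cj B = B.
  by apply/matrixP => i j; rewrite 2!mxE; exact: f_conj.
have BT : B^T = B by rewrite /B map_trmx symA.
have d0 : (v *m vc) 0 0 != 0.
  apply: contra v0; rewrite mxE => /eqP s0; apply/eqP/rowP => j; rewrite mxE.
  have h := psumr_eq0P _ s0.
  have /eqP : v 0 j * vc j 0 = 0.
    by apply: h => // i _; rewrite !mxE mul_conjC_ge0.
  by rewrite !mxE mul_conjC_eq0 => /eqP.
have eB : B *m vc = (Num.conj a) *: vc.
  rewrite -[B in LHS]BT -trmx_mul -{1}Bc -map_mxM vB.
  by rewrite map_mxZ -linearZ.
have : v *m B *m vc = v *m (B *m vc) by rewrite mulmxA.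
rewrite vB eB -scalemxAl -scalemxAr => /matrixP/(_ 0 0).
rewrite mxE [RHS]mxE => /(mulIf d0)/esym/CrealP/complex_realP[b ab].
by exists b; rewrite -(eigenvalue_map f) -[f b]/(b%:C)%C -ab.
Qed.

Lemma sym_max_eigenvalue n (A : 'M[R]_n) : (0 < n)%N -> A^T = A ->
  exists2 a, eigenvalue A a & forall b, eigenvalue A b -> b <= a.
Proof.
move=> n_gt0 symA; have [a0 Aa0] := sym_has_eigenvalue n_gt0 symA.
have p0 : char_poly A != 0 := monic_neq0 (char_poly_monic A).
have Es b : eigenvalue A b = (b \in rootsR (char_poly A)).
  by rewrite eigenvalue_root_char -roots_on_rootsR // in_itv.
have [m ms mP] : exists2 m, m \in rootsR (char_poly A) &
    forall b, b \in rootsR (char_poly A) -> b <= m.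
  have : rootsR (char_poly A) != [::].
    by apply: contraTneq Aa0; rewrite Es => ->.
  elim: (rootsR _) => // x [_ _|y s /(_ isT)[m ms mP] _].
    by exists x => [|b]; rewrite !inE // => /eqP->.
  case: (leP x m) => [xm|/ltW mx].
    exists m => [|b]; rewrite inE ?ms ?orbT // => /predU1P[->//|]; exact: mP.
  exists x => [|b]; rewrite inE ?eqxx // => /predU1P[->//|/mP bm].
  exact: le_trans mx.
by exists m => [|b]; rewrite Es //; apply: mP.
Qed.

Lemma eig_maxP n (A : 'M[R]_n) : (0 < n)%N -> A^T = A ->
  eigenvalue A (eig_max A) /\ forall a, eigenvalue A a -> a <= eig_max A.
Proof.
move=> n_gt0 /(sym_max_eigenvalue n_gt0)[m Am mP].
suff -> : eig_max A = m by [].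
apply/le_anti/andP; split; first by apply: ge_sup => //; exists m.
by apply: ub_le_sup => //; exists m.
Qed.

Lemma eigenvalueN n (A : 'M[R]_n) a : eigenvalue (- A) (- a) = eigenvalue A a.
Proof.
suff h (B : 'M[R]_n) b : eigenvalue B b -> eigenvalue (- B) (- b).
  by apply/idP/idP => [/h|/h //]; rewrite !opprK.
case/eigenvalueP => v vB v0; apply/eigenvalueP; exists v => //.
by rewrite mulmxN vB scaleNr.
Qed.

Lemma eig_minP n (A : 'M[R]_n) : (0 < n)%N -> A^T = A ->
  eigenvalue A (eig_min A) /\ forall a, eigenvalue A a -> eig_min A <= a.
Proof.
move=> n_gt0 symA.
have [] : exists2 m, eigenvalue A m & forall b, eigenvalue A b -> m <= b.
  have [|m Am mP] := @sym_max_eigenvalue n (- A) n_gt0.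
    by rewrite linearN /= symA.
  exists (- m); first by rewrite -eigenvalueN opprK.
  by move=> b Ab; rewrite lerNl mP // eigenvalueN.
move=> m Am mP.
suff -> : eig_min A = m by [].
apply/le_anti/andP; split; first by apply: ge_inf => //; exists m.
by apply: lb_le_inf => //; exists m.
Qed.

Definition spread (G : sgraph) : R := eig_max (adj_mx G) - eig_min (adj_mx G).

Definition signless_spread (G : sgraph) : R :=
  eig_max (signless_laplacian G) - eig_min (signless_laplacian G).

End Spectra.

(* Main.v *)
Require Import Defs.
From mathcomp Require Import all_boot all_order all_algebra.
From mathcomp Require Import all_classical all_reals all_analysis.
From mathcomp Require Import spectral sesquilinear complex.
From mathcomp Require Import zify ring lra.

(** Let f send each vertex of the cycle c to the next one, and every other
vertex to a neighbour nearer the cycle. Uniqueness of the cycle makes the edges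
of G exactly the pairs {v, f v}, one for each vertex v. Hence the vertex-edge
incidence matrix M is square. Since Q = M^T M, while M M^T is 2 I plus the
adjacency matrix of the line graph, the eigenvalues of the line graph are those
of Q shifted by -2. This gives the two equalities.

For the inequality, the hypothesis yields
lambda1 - lambdan <= 2 lambda1 - (1 - cos (pi / (D0 + 1))), so it suffices that
qn <= nu + 1 - cos (pi / (D0 + 1)) for some nu <= q1 - 2 lambda1. A positive nu
is needed, because qn can exceed 1 - cos (pi / (D0 + 1)). If G is a cycle, then
Q = A + 2 I and both spreads agree. Otherwise two kinds of bounds are compared.

- Gap (signless_ge_double): q1 >= 2 lambda1 + (lambda1 - 2) / (lambda1 + 2).
  If lambda1 is large the second term is a gap; if it is not, any lower bound
  q0 on q1 gives one. So a numerical q0 yields a numerical nu (spectral_gap).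
  Such a q0 comes from a vertex weight supported near a cycle vertex that
  carries a branch (signless_family).

- Least eigenvalue (edge_family): qn is at most the quotient
  |M^T y|^2 / |y|^2 of any edge weight y. Weights on the forward orbit under f
  of a vertex at depth p, which is a path of length p ending in the cycle, give
  a bound that decreases with p and with the girth g. For g >= 7 an alternating
  parabola on a path inside the orbit gives qn <= 10 / (n^2 + 1) for every n up
  to p + g (qn_path); for g = 3 and g = 5 explicit integer weights are used.

Let h be attained by the tree at the root u, and let p be its depth. If u has
two children off the cycle, then h <= 2 p and u has degree at least 4, which
makes q1 large. If it has only one, then h <= max (p, 2 p - 2). Either way D0 is
bounded in terms of g and p (deep_branch), and the comparison reduces to
finitely many rational inequalities: when p + g is large, qn is below nu without
the help of the cosine. The gap found in this way is too small only for a
triangle or a pentagon with a single vertex off the cycle; there lambda1 is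
bounded by means of a positive vector w with A w <= L w (lambda1_le). *)

Set Implicit Arguments.
Unset Strict Implicit.
Unset Printing Implicit Defensive.

Import Order.TTheory GRing.Theory Num.Theory numFieldNormedType.Exports.

Local Open Scope ring_scope.

(** * A rational lower bound for 1 - cos (pi / D) *)

Section Trigonometry.
Variable R : realType.
Implicit Types (x y : R) (k F : R -> R).

(** Each Taylor inequality below is the derivative of the next one up to sign,
and all of them vanish at 0, so this lemma lifts them one degree at a time. *)
Lemma ge0_of_derive_ge0 F k : (forall x, is_derive x 1 F (k x)) ->
  F 0 = 0 -> (forall x, 0 <= x -> 0 <= k x) -> forall x, 0 <= x -> 0 <= F x.
Proof.
move=> dF F0 k0 x x0; rewrite -F0.
apply: (@ger0_derive1_ndecry _ F 0) => //.
- move=> y; rewrite in_itv /= andbT => /ltW y0.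
  by rewrite derive1E; have [_ ->] := dF y; apply: k0.
- apply/continuous_subspaceT; move=> y; apply/differentiable_continuous.
  by apply/derivable1_diffP; have [dy _] := dF y; exact: dy.
Qed.

Lemma cos_sin_taylor x : 0 <= x ->
  [/\ cos x <= 1 - x ^+ 2 / 2 + x ^+ 4 / 24, x - x ^+ 3 / 6 <= sin x &
      sin x <= x - x ^+ 3 / 6 + x ^+ 5 / 120].
Proof.
have s1 y : 0 <= y -> 0 <= y - sin y.
  apply: (@ge0_of_derive_ge0 (fun y => y - sin y) (fun y => 1 - cos y)).
  - by rewrite sin0 subr0.
  - by move=> z _; rewrite subr_ge0 cos_le1.
have c2 y : 0 <= y -> 0 <= cos y - 1 + y ^+ 2 / 2.
  apply: (@ge0_of_derive_ge0 (fun y => cos y - 1 + y ^+ 2 / 2)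
    (fun y => y - sin y)) => //.
  - by move=> z; apply: is_derive_eq; rewrite /GRing.scale /=; field.
  - by rewrite cos0 expr0n /=; ring.
have s3 y : 0 <= y -> 0 <= sin y - y + y ^+ 3 / 6.
  apply: (@ge0_of_derive_ge0 (fun y => sin y - y + y ^+ 3 / 6)
    (fun y => cos y - 1 + y ^+ 2 / 2)) => //.
  - by move=> z; apply: is_derive_eq; rewrite /GRing.scale /=; field.
  - by rewrite sin0 expr0n /=; ring.
have c4 y : 0 <= y -> 0 <= - cos y + 1 - y ^+ 2 / 2 + y ^+ 4 / 24.
  apply: (@ge0_of_derive_ge0
    (fun y => - cos y + 1 - y ^+ 2 / 2 + y ^+ 4 / 24)
    (fun y => sin y - y + y ^+ 3 / 6)) => //.
  - by move=> z; apply: is_derive_eq; rewrite /GRing.scale /=; field.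
  - by rewrite cos0 !expr0n /=; ring.
have s5 y : 0 <= y -> 0 <= - sin y + y - y ^+ 3 / 6 + y ^+ 5 / 120.
  apply: (@ge0_of_derive_ge0
    (fun y => - sin y + y - y ^+ 3 / 6 + y ^+ 5 / 120)
    (fun y => - cos y + 1 - y ^+ 2 / 2 + y ^+ 4 / 24)) => //.
  - by move=> z; apply: is_derive_eq; rewrite /GRing.scale /=; field.
  - by rewrite sin0 !expr0n /=; ring.
by move=> x0; split; [have := c4 x x0|have := s3 x x0|have := s5 x x0]; lra.
Qed.

(** With y = 3.139 / 4, pi < 3.139 would give cos (2 y) < cos (pi / 2) = 0,
whereas cos (2 y) = 1 - 2 sin^2 y is positive because sin y <= 0.7069. *)
Lemma pi_ge : 3139 / 1000 <= pi :> R.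
Proof.
rewrite leNgt; apply/negP => pi_lt.
have p2 := pi_ge2 R.
have [y [y0 yl yr s0 s1]] : exists y : R, [/\ 0 <= y, y *+ 2 <= 2,
    pi / 2 < y *+ 2, 0 <= y - y ^+ 3 / 6
    & y - y ^+ 3 / 6 + y ^+ 5 / 120 <= 7069 / 10000].
  by exists (3139 / 4000); split; lra.
have [_ sy0 sy] := cos_sin_taylor y0.
have : cos (y *+ 2) < cos (pi / 2).
  have yp : y *+ 2 <= pi := le_trans yl p2.
  have y2 : 0 <= y *+ 2 by rewrite mulrn_wge0.
  have ph0 : 0 <= pi / 2 :> R by rewrite divr_ge0 ?pi_ge0.
  by rewrite ltr_cos // in_itv /= ?y2 ?ph0 //=; move: p2; clear; lra.
rewrite cos_pihalf cos_mulr2n mulr2n cos2sin2.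
have : sin y ^+ 2 <= (7069 / 10000) ^+ 2.
  by apply: lerXn2r; rewrite ?nnegrE;
    [exact: le_trans sy0|clear; lra|exact: le_trans s1].
by move: (sin y ^+ 2); clear => z; lra.
Qed.

(** The constants are 3.139^2 / 2 rounded down and 3.139^4 / 24 rounded up.
Allowing D' <= D makes it enough to know an integer upper bound of the
denominator. *)
Lemma one_sub_cos_pi_div_ge (D D' : R) : 2 <= D' -> D' <= D ->
  4926 / 1000 / D ^+ 2 - 405 / 100 / D ^+ 4 <= 1 - cos (pi / D').
Proof.
move=> D2 DD.
have D0 : 0 < D by lra.
have D'0 : 0 < D' by lra.
have [a [a0 a_pi a2 a4]] : exists a : R,
    [/\ 0 <= a, a <= pi, 4926 / 1000 <= a ^+ 2 / 2 & a ^+ 4 / 24 <= 405 / 100].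
  exists (3139 / 1000); split; [lra | exact: pi_ge | lra | lra].
have pi0 := pi_gt0 R.
have y0 : 0 <= a / D by apply: divr_ge0 => //; apply: ltW.
have yp : a / D <= pi / D'.
  apply: ler_pM => //; first by rewrite invr_ge0 ltW.
  by rewrite lef_pV2.
have [cy _ _] := cos_sin_taylor y0.
have : cos (pi / D') <= cos (a / D).
  have pD : pi / D' <= pi by rewrite ler_pdivrMr // ler_peMr ?ltW //; lra.
  have p'0 := le_trans y0 yp; have ap := le_trans yp pD.
  by rewrite leNgt ltr_cos ?in_itv /= -?leNgt ?y0 ?p'0.
move: cy; rewrite !exprMn !exprVn.
have d2 : 0 <= (D ^+ 2)^-1 by rewrite invr_ge0 exprn_ge0 // ltW.
have d4 : 0 <= (D ^+ 4)^-1 by rewrite invr_ge0 exprn_ge0 // ltW.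
have := ler_wpM2r d2 a2; have := ler_wpM2r d4 a4.
by move: (cos _) (cos _) (a ^+ 2) (a ^+ 4) (D ^+ 2)^-1 (D ^+ 4)^-1;
  clear=> *; lra.
Qed.

End Trigonometry.

(** * Rayleigh quotients of real symmetric matrices *)

Section Rayleigh.
Variable R : realType.

(** Over the complex closure A is unitarily diagonalizable; in the new
coordinates y the form is a sum of d_i |y_i|^2 whose coefficients d_i are
real eigenvalues of A, hence at most the largest one. *)
Lemma rayleigh_max n (A : 'M[R]_n) (x : 'rV[R]_n) : A^T = A ->
  (x *m A *m x^T) 0 0 <= eig_max A * (x *m x^T) 0 0.
Proof.
case: n A x => [|n] A x symA.
  by rewrite [x]thinmx0 !mul0mx mxE mulr0.
pose f : {rmorphism R -> complex R} := real_complex_def (Phant R).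
have f_conj z : Num.conj (f z) = f z.
  by apply/conj_Creal/complex_realP; exists z.
pose B := map_mx f A; pose X := map_mx f x.
have XC : map_mx Num.conj X = X by apply/matrixP => i j; rewrite !mxE.
have Bherm : B \is hermsymmx.
  apply: realsym_hermsym.
    by apply/is_hermitianmxP; rewrite expr0 scale1r map_mx_id // map_trmx symA.
  by apply/mxOverP => i j; rewrite mxE; apply/complex_realP; exists (A i j).
have BE := orthomx_spectralP (hermitian_normalmx Bherm).
have /mxOverP dR := hermitian_spectral_diag_real Bherm.
have Punit := spectral_unit B; have Pun := spectral_unitarymx B.
move: BE dR Punit Pun; set P := spectralmx B; set d := spectral_diag B.
move=> BE dR Punit Pun.
have d_le i : d 0 i <= f (eig_max A).
  have /complex_realP[a da] := dR 0 i.
  rewrite da lecR; apply: (eig_maxP _ symA).2 => //.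
  rewrite -(eigenvalue_map f); apply/eigenvalueP; exists (row i P).
    rewrite -/B {1}BE rowE !mulmxA mulmxK // -[_ *m diag_mx d]rowE row_diag_mx.
    by rewrite -scalemxAl da.
  apply: contraTneq Punit => r0; rewrite -row_free_unit.
  apply/negP => /row_freeP[P' /(congr1 (row i))].
  rewrite row_mul r0 mul0mx => /rowP/(_ i); rewrite !mxE eqxx => /eqP.
  by rewrite eq_sym oner_eq0.
rewrite -lecR.
have PCK : map_mx Num.conj (map_mx Num.conj P^T) = P^T.
  by rewrite -map_mx_comp; apply: map_mx_id => z; apply: conjCK.
pose y := X *m map_mx Num.conj P^T.
have -> : ((x *m A *m x^T) 0 0)%:C%C =
    \sum_i d 0 i * (y 0 i * Num.conj (y 0 i)).
  transitivity ((X *m B *m X^T) 0 0).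
    by rewrite /X /B map_trmx -!map_mxM [RHS]mxE.
  rewrite [B]BE invmx_unitary // -{2}XC.
  have -> : X *m (map_mx Num.conj P^T *m diag_mx d *m P) *m
      (map_mx Num.conj X)^T =
     y *m diag_mx d *m (map_mx Num.conj y)^T.
    rewrite /y map_mxM PCK trmx_mul trmxK.
    by rewrite !mulmxA.
  rewrite mxE; apply: eq_bigr => i _.
  by rewrite mul_mx_diag !mxE mulrA [_ * d 0 i]mulrC.
have -> : (eig_max A * (x *m x^T) 0 0)%:C%C =
    \sum_i f (eig_max A) * (y 0 i * Num.conj (y 0 i)).
  rewrite -mulr_sumr rmorphM /=; congr (_ * _).
  transitivity ((X *m X^T) 0 0).
    by rewrite /X map_trmx -!map_mxM [RHS]mxE.
  transitivity ((y *m (map_mx Num.conj y)^T) 0 0); last first.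
    by rewrite mxE; apply: eq_bigr => i _; rewrite !mxE.
  rewrite /y map_mxM PCK trmx_mul trmxK XC.
  by rewrite mulmxA -[X *m _ *m P]mulmxA -(invmx_unitary Pun) mulVmx // mulmx1.
by apply: ler_sum => i _; apply: ler_wpM2r => //; rewrite mul_conjC_ge0.
Qed.

End Rayleigh.

Section EigenvalueTransfer.
Variable R : realType.

Lemma eig_min_opp n (A : 'M[R]_n) : (0 < n)%N -> A^T = A ->
  eig_min A = - eig_max (- A).
Proof.
move=> n0 symA; have symN : (- A)^T = - A by rewrite linearN /= symA.
have [Am Amin] := eig_minP n0 symA; have [NM Nmax] := eig_maxP n0 symN.
apply/le_anti/andP; split; first by apply: Amin; rewrite -eigenvalueN opprK.
by rewrite lerNl; apply: Nmax; rewrite eigenvalueN.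
Qed.

Lemma rayleigh_min n (A : 'M[R]_n) (x : 'rV[R]_n) : A^T = A ->
  eig_min A * (x *m x^T) 0 0 <= (x *m A *m x^T) 0 0.
Proof.
case: n A x => [|n] A x symA; first by rewrite [x]thinmx0 !mul0mx mxE mulr0.
rewrite eig_min_opp // mulNr lerNl.
have symN : (- A)^T = - A by rewrite linearN /= symA.
have := rayleigh_max x symN; apply: le_trans.
by rewrite mulmxN mulNmx [leRHS]mxE.
Qed.

Lemma eig_shift m n (A : 'M[R]_m) (B : 'M[R]_n) c :
  (0 < m)%N -> (0 < n)%N -> A^T = A -> B^T = B ->
  (forall a, eigenvalue A a = eigenvalue B (a + c)) ->
  eig_max B = eig_max A + c /\ eig_min B = eig_min A + c.
Proof.
move=> m0 n0 symA symB AB.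
have [AM Amax] := eig_maxP m0 symA; have [BM Bmax] := eig_maxP n0 symB.
have [Am Amin] := eig_minP m0 symA; have [Bm Bmin] := eig_minP n0 symB.
split; apply/le_anti/andP; split.
- by rewrite -lerBlDr; apply: Amax; rewrite AB subrK.
- by apply: Bmax; rewrite -AB.
- by apply: Bmin; rewrite -AB.
- by rewrite -lerBrDr; apply: Amin; rewrite AB subrK.
Qed.

(** For square factors this includes the eigenvalue 0: if v A = 0 with v <> 0
then A, and so B A, is singular. *)
Lemma eigenvalue_mulC n (A B : 'M[R]_n) a :
  eigenvalue (A *m B) a = eigenvalue (B *m A) a.
Proof.
suff h (C D : 'M[R]_n) : eigenvalue (C *m D) a -> eigenvalue (D *m C) a.
  by apply/idP/idP; apply: h.
case/eigenvalueP => v vCD v0.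
have [vC0|vC0] := eqVneq (v *m C) 0; last first.
  apply/eigenvalueP; exists (v *m C) => //.
  by rewrite mulmxA -[v *m C *m D]mulmxA vCD scalemxAl.
have a0 : a = 0.
  apply/eqP; move: vCD; rewrite mulmxA vC0 mul0mx => /esym/eqP.
  by rewrite scaler_eq0 (negPf v0) orbF.
have det0 : D *m C \notin unitmx.
  rewrite unitmx_mul negb_and; apply/orP; right.
  apply: contraNN v0 => Cu; apply/eqP.
  by rewrite -(mulmxK Cu v) vC0 mul0mx.
by rewrite a0 /eigenvalue /eigenspace raddf0 subr0 kermx_eq0 row_free_unit.
Qed.

End EigenvalueTransfer.

(** * Matrices indexed by a finite type *)

Section Kernels.
Variables (R : realType) (T : finType).
Implicit Types (K : T -> T -> R) (x : T -> R).

(** The enumeration of T is confined to this definition and to the lemmas on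
it, so that the spectral arguments can be carried out with functions on the
vertices. *)
Definition kernel_mx K : 'M[R]_#|T| :=
  \matrix_(i, j) K (enum_val i) (enum_val j).

Definition vec_of x : 'rV[R]_#|T| := \row_i x (enum_val i).

Lemma vec_ofK (v : 'rV[R]_#|T|) : v = vec_of (fun u => v 0 (enum_rank u)).
Proof. by apply/rowP => i; rewrite mxE enum_valK. Qed.

Lemma sum_enum_val (F : T -> R) : \sum_(i < #|T|) F (enum_val i) = \sum_u F u.
Proof. by rewrite -(big_enum_val (A := predT)). Qed.

Lemma kernel_tr K : (kernel_mx K)^T = kernel_mx (fun u v => K v u).
Proof. by apply/matrixP => i j; rewrite !mxE. Qed.

Lemma kernel_mul K K' :
  kernel_mx K *m kernel_mx K' = kernel_mx (fun u v => \sum_w K u w * K' w v).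
Proof.
apply/matrixP => i j; rewrite !mxE.
rewrite -(sum_enum_val (fun w => K (enum_val i) w * K' w (enum_val j))).
by apply: eq_bigr => k _; rewrite !mxE.
Qed.

Lemma vec_of_mul x K :
  vec_of x *m kernel_mx K = vec_of (fun v => \sum_u x u * K u v).
Proof.
apply/rowP => i; rewrite !mxE -(sum_enum_val (fun u => x u * K u (enum_val i))).
by apply: eq_bigr => k _; rewrite !mxE.
Qed.

Lemma vec_of_dot x (y : T -> R) :
  (vec_of x *m (vec_of y)^T) 0 0 = \sum_u x u * y u.
Proof.
rewrite mxE -(sum_enum_val (fun u => x u * y u)).
by apply: eq_bigr => k _; rewrite !mxE.
Qed.

Lemma kernel_eigenP K a :
  reflect (exists2 x, (exists u, x u != 0) &
             forall v, \sum_u x u * K u v = a * x v)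
          (eigenvalue (kernel_mx K) a).
Proof.
apply: (iffP eigenvalueP) => [[v vK v0]|[x [u xu] xK]].
  exists (fun u => v 0 (enum_rank u)).
    have [i vi] : exists i, v 0 i != 0 by apply/rV0Pn.
    by exists (enum_val i); rewrite enum_valK.
  move=> w; move: vK; rewrite {1 2}[v]vec_ofK vec_of_mul.
  move=> /rowP/(_ (enum_rank w)).
  by rewrite !mxE enum_rankK.
exists (vec_of x).
  by rewrite vec_of_mul; apply/rowP => i; rewrite !mxE xK.
by apply/rV0Pn; exists (enum_rank u); rewrite mxE enum_rankK.
Qed.

Lemma kernel_rayleigh K x : (forall u v, K u v = K v u) ->
  let form := \sum_v (\sum_u x u * K u v) * x v in
  eig_min (kernel_mx K) * \sum_u x u ^+ 2 <= form /\
  form <= eig_max (kernel_mx K) * \sum_u x u ^+ 2.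
Proof.
move=> Ksym /=.
have symK : (kernel_mx K)^T = kernel_mx K.
  by rewrite kernel_tr; apply/matrixP => i j; rewrite !mxE.
have := rayleigh_max (vec_of x) symK; have := rayleigh_min (vec_of x) symK.
rewrite vec_of_mul !vec_of_dot => h1 h2; split.
  by under eq_bigr do rewrite expr2.
by under [X in _ <= _ * X]eq_bigr do rewrite expr2.
Qed.

End Kernels.

(** * Graphs whose edges are the pairs {v, f v} *)

Section ParentMap.
Variables (R : realType) (G : sgraph) (f : G -> G).
Hypothesis adjE : forall u v, adj u v = (f u == v) || (f v == u).
Hypothesis f2 : forall v, f (f v) != v.

Let A := adj_mx R G.
Let Q := signless_laplacian R G.
Local Notation lambda1 := (eig_max A).
Local Notation q1 := (eig_max Q).
Local Notation qn := (eig_min Q).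

Lemma f_neq v : f v != v.
Proof. by apply/negP => fv; have := adj_irrefl v; rewrite adjE fv. Qed.

Lemma adj_sum u v : (adj u v)%:R = (f u == v)%:R + (f v == u)%:R :> R.
Proof.
rewrite adjE; case: (altP (f u =P v)) => [<-|_]; last by rewrite add0r.
by rewrite (negPf (f2 u)) addr0.
Qed.

Lemma degreeE u : degree u = #|[set c | f c == u]|.+1.
Proof.
rewrite /degree (cardsD1 (f u)) inE adjE eqxx /= add1n; congr _.+1.
apply: eq_card => c; rewrite !inE adjE.
case: (altP (c =P f u)) => [->|cfu] /=; first by rewrite (negPf (f2 u)).
by rewrite eq_sym (negPf cfu).
Qed.

Lemma sum_delta (x : G -> R) u : \sum_v x v * (v == u)%:R = x u.
Proof.
rewrite (bigD1 u) //= eqxx mulr1 big1 ?addr0 // => v /negPf->.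
by rewrite mulr0.
Qed.

Lemma sum_deltaf (x : G -> R) u : \sum_v x v * (u == v)%:R = x u.
Proof. by rewrite -[RHS]sum_delta; under eq_bigr do rewrite eq_sym. Qed.

Lemma sum_children (x : G -> R) u :
  \sum_v x v * (f v == u)%:R = \sum_(c | f c == u) x c.
Proof.
rewrite [RHS]big_mkcond; apply: eq_bigr => v _.
by case: eqP; rewrite ?mulr1 ?mulr0.
Qed.

Lemma sum_over_children (x : G -> G -> R) :
  \sum_u \sum_(c | f c == u) x u c = \sum_c x (f c) c.
Proof.
rewrite (exchange_big_dep xpredT) //=; apply: eq_bigr => c _.
by rewrite (big_pred1 (f c)) // => u; rewrite /= eq_sym.
Qed.

(** The vertex v also names the edge {v, f v}, so that the vertex-edge
incidence matrix is the square matrix of this kernel. *)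
Definition inc (w u : G) : R := (w == u)%:R + (f w == u)%:R.

Lemma sum_inc (x : G -> R) w : \sum_u x u * inc w u = x w + x (f w).
Proof.
under eq_bigr do rewrite mulrDr.
by rewrite big_split /= !sum_deltaf.
Qed.

Lemma sum_inc_tr (y : G -> R) u :
  \sum_w y w * inc w u = y u + \sum_(c | f c == u) y c.
Proof.
under eq_bigr do rewrite mulrDr.
by rewrite big_split /= sum_delta sum_children.
Qed.

Let Qk u v := \sum_w inc w u * inc w v.
Let Nk u v := \sum_w inc u w * inc v w.

Lemma signlessE : Q = kernel_mx Qk.
Proof.
apply/matrixP => i j; rewrite !mxE /Qk.
have -> : \sum_w inc w (enum_val i) * inc w (enum_val j) =
    inc (enum_val i) (enum_val j) +
    \sum_(c | f c == enum_val i) inc c (enum_val j).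
  rewrite -(sum_inc_tr (fun w => inc w (enum_val j))).
  by apply: eq_bigr => w _; rewrite mulrC.
have -> : (i == j) = (enum_val i == enum_val j).
  by rewrite (inj_eq enum_val_inj).
set u := enum_val i; set v := enum_val j.
rewrite adj_sum degreeE /inc big_split /=.
have -> : \sum_(c | f c == u) (c == v)%:R = (f v == u)%:R :> R.
  rewrite -sum_children -[RHS](sum_delta (fun c => (f c == u)%:R)).
  by apply: eq_bigr => c _; rewrite mulrC.
have -> : \sum_(c | f c == u) (f c == v)%:R =
    #|[set c | f c == u]|%:R * (u == v)%:R :> R.
  rewrite -sum1_card natr_sum mulr_suml big_mkcond [RHS]big_mkcond /=.
  by apply: eq_bigr => c _; rewrite inE; case: eqP => [->|//]; rewrite mul1r.
rewrite -mulr_natr -[in LHS]add1n natrD; ring.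
Qed.

Lemma kernel_inc_mul :
  kernel_mx Qk = (kernel_mx inc)^T *m kernel_mx inc /\
  kernel_mx Nk = kernel_mx inc *m (kernel_mx inc)^T.
Proof. by rewrite kernel_tr !kernel_mul. Qed.

Lemma signless_form (x : G -> R) :
  qn * \sum_u x u ^+ 2 <= \sum_u (x u + x (f u)) ^+ 2 /\
  \sum_u (x u + x (f u)) ^+ 2 <= q1 * \sum_u x u ^+ 2.
Proof.
have Qsym u v : Qk u v = Qk v u by apply: eq_bigr => w _; rewrite mulrC.
have := kernel_rayleigh x Qsym.
suff -> : \sum_v (\sum_u x u * Qk u v) * x v = \sum_u (x u + x (f u)) ^+ 2.
  by rewrite signlessE.
transitivity (\sum_v \sum_w (x w + x (f w)) * inc w v * x v).
  apply: eq_bigr => v _; rewrite -mulr_suml; congr (_ * _).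
  under eq_bigr do rewrite /Qk mulr_sumr.
  rewrite exchange_big /=; apply: eq_bigr => w _.
  by rewrite -sum_inc mulr_suml; apply: eq_bigr => u _; rewrite mulrA.
rewrite exchange_big /=; apply: eq_bigr => w _.
rewrite expr2 -[X in _ = _ * X]sum_inc mulr_sumr; apply: eq_bigr => v _.
by rewrite -mulrA [inc _ _ * _]mulrC.
Qed.

Hypothesis G_gt0 : (0 < #|G|)%N.

(** Q = M^T M for the incidence matrix M, and M M^T has the same spectrum
because M is square. *)
Lemma edge_spectrum :
  eig_max (kernel_mx Nk) = q1 /\ eig_min (kernel_mx Nk) = qn.
Proof.
have [QE NE] := kernel_inc_mul.
have [] := @eig_shift R _ _ (kernel_mx Qk) (kernel_mx Nk) 0 G_gt0 G_gt0.
- by rewrite QE trmx_mul trmxK.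
- by rewrite NE trmx_mul trmxK.
- by move=> a; rewrite addr0 QE NE eigenvalue_mulC.
by rewrite !addr0 signlessE.
Qed.

(** Weights y on the edges bound the same extreme eigenvalues as weights on
the vertices, through the form |M^T y|^2. Unlike a vertex weight, an edge
weight pays nothing for the edges leaving its support. *)
Lemma edge_form (y : G -> R) :
  qn * \sum_u y u ^+ 2 <= \sum_u (y u + \sum_(c | f c == u) y c) ^+ 2 /\
  \sum_u (y u + \sum_(c | f c == u) y c) ^+ 2 <= q1 * \sum_u y u ^+ 2.
Proof.
have Nsym u v : Nk u v = Nk v u by apply: eq_bigr => w _; rewrite mulrC.
have := kernel_rayleigh y Nsym; have [-> ->] := edge_spectrum.
suff -> : \sum_v (\sum_u y u * Nk u v) * y v =
    \sum_u (y u + \sum_(c | f c == u) y c) ^+ 2 by [].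
transitivity (\sum_v \sum_w (y w + \sum_(c | f c == w) y c) * inc v w * y v).
  apply: eq_bigr => v _; rewrite -mulr_suml; congr (_ * _).
  under eq_bigr do rewrite /Nk mulr_sumr.
  rewrite exchange_big /=; apply: eq_bigr => w _.
  by rewrite -sum_inc_tr mulr_suml; apply: eq_bigr => u _; rewrite mulrA.
rewrite exchange_big /=; apply: eq_bigr => w _.
rewrite expr2 -[X in _ = _ * X]sum_inc_tr mulr_sumr; apply: eq_bigr => v _.
by rewrite -mulrA [inc _ _ * _]mulrC.
Qed.

Lemma edge_of_inj : injective (fun v => [set v; f v]).
Proof.
move=> u v uv; apply/eqP; apply/negPn/negP => neq_uv.
have : u \in [set v; f v] by rewrite -uv set21.
have : v \in [set u; f u] by rewrite uv set21.
rewrite !inE (negPf neq_uv) eq_sym (negPf neq_uv) /= => /eqP vfu /eqP ufv.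
by have := f2 u; rewrite -vfu -ufv eqxx.
Qed.

Lemma edge_of_edges v : [set v; f v] \in edges G.
Proof. by apply/imsetP; exists (v, f v); rewrite ?inE //= adjE eqxx. Qed.

Definition edge_of v : line_graph G := Sub [set v; f v] (edge_of_edges v).

Lemma edge_of_bij : bijective edge_of.
Proof.
have inj : injective edge_of by move=> u v /(congr1 val); apply: edge_of_inj.
have surj (e : line_graph G) : exists v, edge_of v == e.
  have /imsetP[[u v] /=] := valP e.
  rewrite inE /= adjE => /orP[/eqP fu|/eqP fv] ee.
    by exists u; apply/eqP/val_inj; apply: etrans (esym ee); rewrite /= fu.
  exists v; apply/eqP/val_inj; apply: etrans (esym ee).
  by rewrite /= fv finset.setUC.
by exists (fun e => xchoose (surj e)) => [v|e];
  [apply: inj|]; apply/eqP/(xchooseP (surj _)).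
Qed.

Lemma line_kernel u v :
  Nk u v = 2 * (u == v)%:R + (adj (edge_of u) (edge_of v))%:R.
Proof.
have -> : Nk u v = inc v u + inc v (f u).
  by rewrite -sum_inc; apply: eq_bigr => w _; rewrite mulrC.
have -> : adj (edge_of u) (edge_of v) =
    (u != v) && [|| v == u, f v == u, v == f u | f v == f u].
  have [g gK _] := edge_of_bij.
  rewrite {1}/adj /= /line_rel (can_eq gK) -finset.setI_eq0; congr (_ && _).
  apply/set0Pn/idP => [[w]|].
    rewrite !inE => /andP[/pred2P[]-> /pred2P[]->]; rewrite eqxx ?orbT //.
  case/or4P => /eqP vu; [exists u|exists u|exists v|exists (f v)];
   by rewrite !inE vu !eqxx ?orbT.
rewrite /inc; case: (altP (u =P v)) => [<-|uv].
  by rewrite !eqxx [u == _]eq_sym !(negPf (f_neq u)) /=; ring.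
rewrite eq_sym (negPf uv) /= mulr0 !add0r.
case: (altP (f v =P u)) => [fvu|_] /=.
  rewrite -fvu eq_sym (negPf (f2 v)) [f v == _]eq_sym (negPf (f_neq _)).
  by rewrite !addr0.
case: (altP (v =P f u)) => [vfu|_] /=; last by rewrite !add0r.
by rewrite -vfu (negPf (f_neq _)) add0r addr0.
Qed.

(** M M^T = 2 I + A(L), since two distinct edges share at most one vertex. *)
Lemma line_spread : spread R (line_graph G) = q1 - qn.
Proof.
have [g gK Kg] := edge_of_bij.
have line_gt0 : (0 < #|line_graph G|)%N.
  by have /card_gt0P[v _] := G_gt0; apply/card_gt0P; exists (edge_of v).
have symL : (adj_mx R (line_graph G))^T = adj_mx R (line_graph G).
  by apply/matrixP => i j; rewrite !mxE adj_sym.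
have symN : (kernel_mx Nk)^T = kernel_mx Nk.
  by have [_ ->] := kernel_inc_mul; rewrite trmx_mul trmxK.
have [] := @eig_shift R _ _ _ (kernel_mx Nk) 2 line_gt0 G_gt0 symL symN.
  move=> a; apply/(kernel_eigenP (fun e e' => (adj e e')%:R))/kernel_eigenP.
  - case=> z [e ze] zK; exists (z \o edge_of).
      by exists (g e); rewrite /= Kg.
    move=> v; rewrite mulrDl -zK /= (reindex edge_of) /=; last first.
      by apply: onW_bij; exact: edge_of_bij.
    have -> : 2 * z (edge_of v) =
        \sum_u 2 * (z (edge_of u) * (u == v)%:R).
      by rewrite -mulr_sumr (sum_delta (fun u => z (edge_of u))).
    rewrite -big_split /=.
    by apply: eq_bigr => u _; rewrite line_kernel; ring.
  - case=> y [u yu] yK; exists (y \o g).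
      by exists (edge_of u); rewrite /= gK.
    move=> e; have := yK (g e); rewrite mulrDl /=.
    have -> : 2 * y (g e) = \sum_u 2 * (y u * (u == g e)%:R).
      by rewrite -mulr_sumr sum_delta.
    rewrite [in X in _ -> X](reindex edge_of) /=; last first.
      by apply: onW_bij; exact: edge_of_bij.
    under eq_bigr do rewrite line_kernel Kg.
    under [in X in _ -> X]eq_bigr do rewrite gK.
    move=> h; rewrite -[RHS](addrK (\sum_i 2 * (y i * (i == g e)%:R))) -h.
    rewrite -sumrB.
    by apply: eq_bigr => w _; ring.
have [-> ->] := edge_spectrum; rewrite /spread => -> ->; ring.
Qed.

End ParentMap.

(** * The gap between q1 and twice lambda1 *)

Section SpectralGap.
Variables (R : realType) (G : sgraph) (f : G -> G).
Hypothesis adjE : forall u v, adj u v = (f u == v) || (f v == u).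
Hypothesis f2 : forall v, f (f v) != v.
Hypothesis G_gt0 : (0 < #|G|)%N.

Local Notation lambda1 := (eig_max (adj_mx R G)).
Local Notation q1 := (eig_max (signless_laplacian R G)).
Local Notation qn := (eig_min (signless_laplacian R G)).

Lemma lambda1_eigenvector : exists2 x : G -> R, 0 < \sum_u x u ^+ 2 &
  forall u, x (f u) + \sum_(c | f c == u) x c = lambda1 * x u.
Proof.
have symA : (adj_mx R G)^T = adj_mx R G.
  by apply/matrixP => i j; rewrite !mxE adj_sym.
have [/(kernel_eigenP (fun u v => (adj u v)%:R))[x [u xu] xA] _] :=
  eig_maxP G_gt0 symA.
exists x => [|v].
  rewrite (bigD1 u) //= ltr_wpDr ?sumr_ge0 // => [i _|]; first exact: sqr_ge0.
  by rewrite exprn_even_gt0.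
rewrite -xA; under [RHS]eq_bigr do rewrite (adj_sum R adjE f2) mulrDr.
by rewrite big_split /= sum_children sum_deltaf addrC.
Qed.

(** Take x a top eigenvector of A and give the edge {v, f v} the weight
x_v + x_(f v). Then |M^T y|^2 <= q1 |y|^2 bounds q1 below by moments of the
degree d under the distribution x^2. Two facts control them. Comparing x with
x o f in the Cauchy-Schwarz inequality gives E d >= 1 + lambda1^2 / 4, and
(d - 2) (d - 3) >= 0 for integers gives E d^2 >= 5 E d - 6. Below, k = d - 1
counts the preimages of a vertex. *)
Lemma signless_ge_double (lambda1_gt0 : 0 < lambda1) :
  2 * lambda1 + (lambda1 - 2) / (lambda1 + 2) <= q1.
Proof.
have [x s_gt0 xA] := lambda1_eigenvector; set l := lambda1 in xA lambda1_gt0 *.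
set s := \sum_u x u ^+ 2 in s_gt0.
pose k u : R := #|[set c | f c == u]|%:R.
have sum_k u a : \sum_(c | f c == u) a = k u * a.
  rewrite sumr_const -mulr_natl /k; congr (_%:R * _).
  by apply: eq_card => c; rewrite !inE.
pose K := \sum_u k u * x u ^+ 2.
have xfx : 2 * \sum_u x u * x (f u) = l * s.
  transitivity (\sum_u x u * (x (f u) + \sum_(c | f c == u) x c)).
    rewrite mulr_natl mulr2n.
    under [RHS]eq_bigr do rewrite mulrDr mulr_sumr.
    rewrite big_split /= (sum_over_children f (fun u c => x u * x c)).
    by congr (_ + _); apply: eq_bigr => u _; rewrite mulrC.
  by rewrite mulr_sumr; apply: eq_bigr => u _; rewrite xA; ring.
have xf2 : \sum_u x (f u) ^+ 2 = K.
  rewrite -(sum_over_children f (fun u c => x u ^+ 2)).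
  by apply: eq_bigr => u _; rewrite sum_k.
have K_ge : l ^+ 2 / 4 * s <= K.
  have : 0 <= \sum_u (x (f u) - l / 2 * x u) ^+ 2.
    by apply: sumr_ge0 => u _; exact: sqr_ge0.
  have -> : \sum_u (x (f u) - l / 2 * x u) ^+ 2 =
      \sum_u x (f u) ^+ 2 - l * \sum_u x u * x (f u) + l ^+ 2 / 4 * s.
    rewrite !mulr_sumr -sumrB -big_split /=.
    by apply: eq_bigr => u _; field.
  by rewrite xf2; nra.
pose y u := x u + x (f u).
have y2 : \sum_u y u ^+ 2 = (1 + l) * s + K.
  rewrite mulrDl mul1r -xfx -xf2 mulr_sumr -!big_split /=.
  by apply: eq_bigr => u _; rewrite /y; ring.
have [_] := edge_form adjE f2 G_gt0 y; rewrite y2.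
have -> : \sum_u (y u + \sum_(c | f c == u) y c) ^+ 2 =
    \sum_u ((1 + l) + k u) ^+ 2 * x u ^+ 2.
  apply: eq_bigr => u _; rewrite -exprMn; congr (_ ^+ 2).
  have -> : \sum_(c | f c == u) y c = \sum_(c | f c == u) x c + k u * x u.
    rewrite /y big_split /= -sum_k; congr (_ + _).
    by apply: eq_bigr => c /eqP->.
  by have := xA u; rewrite /y => h; rewrite !mulrDl mul1r -h; ring.
have : (1 + l) ^+ 2 * s + 2 * (1 + l) * K + (3 * K - 2 * s) <=
    \sum_u ((1 + l) + k u) ^+ 2 * x u ^+ 2.
  rewrite /s /K !mulr_sumr -sumrB -!big_split /=; apply: ler_sum => u _.
  have : 0 <= (k u - 1) * (k u - 2) * x u ^+ 2.
    apply: mulr_ge0; last exact: sqr_ge0.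
    rewrite /k; case: #|_| => [|[|j]]; rewrite ?mulr0n; try lra.
    by rewrite -!natr1; have := ler0n R j; nra.
  by move: (x u ^+ 2) => z; lra.
move=> h1 h2; have {h1 h2} h := le_trans h1 h2.
have [K' KE] : exists K', K = K' * s by exists (K / s); rewrite divfK ?gt_eqF.
rewrite {}KE in K_ge h; move: K_ge; rewrite ler_pM2r // => K_ge.
have {}h : (1 + l) ^+ 2 + 2 * (1 + l) * K' + (3 * K' - 2) <=
    q1 * ((1 + l) + K').
  by rewrite -(ler_pM2r s_gt0); move: h; lra.
have l2 : 0 < l + 2 by lra.
have -> : 2 * l + (l - 2) / (l + 2) = 5 + 2 * l - (l + 3) * (4 / (l + 2)).
  by field; lra.
have K'0 : 0 < 1 + l + K' by have := sqr_ge0 l; lra.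
rewrite lerBlDr -lerBlDl.
have : (l + 2) * (l + 3) / (1 + l + K') <= (l + 3) * (4 / (l + 2)).
  rewrite [(l + 2) * _]mulrC -mulrA ler_pM2l; last lra.
  by rewrite ler_pdivrMr // mulrAC ler_pdivlMr //; nra.
apply: le_trans.
by rewrite ler_pdivlMr //; nra.
Qed.

(** If the gap were below nu, then 2 lambda1 > q0 - nu would be so large that
(lambda1 - 2) / (lambda1 + 2), an increasing function of lambda1, exceeds
nu. *)
Lemma spectral_gap nu q0 : 0 <= nu < 1 -> q0 <= q1 ->
  4 * (1 + nu) + nu * (1 - nu) <= q0 * (1 - nu) -> nu <= q1 - 2 * lambda1.
Proof.
case/andP=> nu0 nu1 q01 q0_ge; rewrite leNgt; apply/negP => lt_nu.
have := signless_ge_double; move: q01 q0_ge lt_nu nu0 nu1.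
move: lambda1 q1 => l q q01 q0_ge lt_nu nu0 nu1.
have nu1' : 0 < 1 - nu by lra.
have l_gt : 2 * (1 + nu) < l * (1 - nu).
  have := ler_wpM2r (ltW nu1') q01.
  have : (q - 2 * l) * (1 - nu) < nu * (1 - nu) by rewrite ltr_pM2r.
  clear -q0_ge; lra.
have l_gt0 : 0 < l.
  by rewrite -(pmulr_lgt0 _ nu1'); apply: le_lt_trans l_gt; lra.
move=> /(_ l_gt0).
have : nu <= (l - 2) / (l + 2) by rewrite ler_pdivlMr; lra.
by clear -lt_nu; lra.
Qed.

(** A list vs of distinct vertices on which f acts by f (vs_i) = vs_(s i) turns
vectors supported on vs into finite numerical sums; the value n of s stands
for a parent outside vs. *)
Section Families.
Variables (x0 : G) (vs : seq G) (s : nat -> nat).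
Hypothesis vs_uniq : uniq vs.
Local Notation n := (size vs).
Local Notation v_ := (nth x0 vs).
Hypothesis f_vs : forall i, (i < n)%N -> index (f (v_ i)) vs = s i.

Lemma sum_family (F : G -> R) : (forall v, v \notin vs -> F v = 0) ->
  \sum_v F v = \sum_(0 <= i < size vs) F (nth x0 vs i).
Proof.
move=> F0; rewrite -(big_nth x0 xpredT F) [RHS]big_uniq //= [RHS]big_mkcond /=.
by apply: eq_bigr => v _; case: ifPn => // /F0.
Qed.

Lemma ler_sum_family (F : G -> R) : (forall v, 0 <= F v) ->
  \sum_(0 <= i < size vs) F (nth x0 vs i) <= \sum_v F v.
Proof.
move=> F0; rewrite -(big_nth x0 xpredT F) [leLHS]big_uniq //= big_mkcond /=.
by apply: ler_sum => v _; case: ifP.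
Qed.

Lemma signless_family (z : nat -> R) : z n = 0 ->
  \sum_(0 <= i < n) (z i + z (s i)) ^+ 2 <= q1 * \sum_(0 <= i < n) z i ^+ 2.
Proof.
move=> zn; pose Z v := z (index v vs).
have Z0 v : v \notin vs -> Z v = 0 by rewrite /Z => /memNindex->.
have [_] := signless_form adjE f2 Z.
rewrite (sum_family (F := fun v => Z v ^+ 2)) => [|v /Z0->]; last first.
  by rewrite expr0n.
under [X in _ <= _ * X]eq_big_nat => i /andP[_ ni] do rewrite /Z index_uniq //.
apply: le_trans.
apply: le_trans (ler_sum_family (fun v => sqr_ge0 (Z v + Z (f v)))).
apply: ler_sum_nat => i /andP[_ ni].
by rewrite /Z index_uniq // f_vs.
Qed.

(** Here s must stay below n: an edge leaving vs would contribute its weight at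
its other end. *)
Lemma edge_family (y : nat -> R) : (forall i, (i < n)%N -> (s i < n)%N) ->
  qn * \sum_(0 <= i < n) y i ^+ 2 <=
  \sum_(0 <= k < n) (y k + \sum_(0 <= i < n | s i == k) y i) ^+ 2.
Proof.
move=> s_lt; pose Y v := if v \in vs then y (index v vs) else 0.
have Y0 v : v \notin vs -> Y v = 0 by rewrite /Y => /negPf->.
have Yv i : (i < n)%N -> Y (v_ i) = y i.
  by move=> ni; rewrite /Y mem_nth // index_uniq.
have fv i : (i < n)%N -> f (v_ i) = v_ (s i).
  by move=> ni; rewrite -f_vs // nth_index // -index_mem f_vs // s_lt.
have [+ _] := edge_form adjE f2 G_gt0 Y.
have Ych u : \sum_(c | f c == u) Y c = \sum_(0 <= i < n | v_ (s i) == u) y i.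
  rewrite big_mkcond (sum_family (F := fun c => if f c == u then Y c else 0)).
    rewrite [RHS]big_mkcond; apply: eq_big_nat => i /andP[_ ni].
    by rewrite fv // Yv.
  by move=> v /Y0->; rewrite if_same.
rewrite (sum_family (F := fun v => Y v ^+ 2)) => [|v /Y0->]; last first.
  by rewrite expr0n.
rewrite sum_family => [|v v_vs]; last first.
  rewrite Y0 // Ych big_nat_cond big1 ?addr0 ?expr0n // => i.
  case/andP=> /andP[_ ni] /eqP vE.
  by move: v_vs; rewrite -vE mem_nth // s_lt.
under [X in _ * X <= _]eq_big_nat => i /andP[_ ni] do rewrite Yv //.
move/le_trans; apply; rewrite le_eqVlt; apply/orP; left; apply/eqP.
apply: eq_big_nat => k /andP[_ nk].
rewrite Yv // Ych; congr ((_ + _) ^+ 2).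
rewrite big_nat_cond [RHS]big_nat_cond; apply: eq_bigl => i.
by case: (ltnP i n) => // ni /=; rewrite nth_uniq // s_lt.
Qed.

End Families.

End SpectralGap.

Section CollatzBound.
Variables (R : realType) (G : sgraph) (f : G -> G).
Hypothesis adjE : forall u v, adj u v = (f u == v) || (f v == u).
Hypothesis f2 : forall v, f (f v) != v.
Hypothesis G_gt0 : (0 < #|G|)%N.
Local Notation lambda1 := (eig_max (adj_mx R G)).

(** A positive w with A w <= L w: bound each edge term 2 x_u x_(f u) by
(w_(f u) / w_u) x_u^2 + (w_u / w_(f u)) x_(f u)^2 and collect at each vertex. *)
Lemma lambda1_le (w : G -> R) L : (forall u, 0 < w u) ->
  (forall u, w (f u) + \sum_(v | f v == u) w v <= L * w u) -> lambda1 <= L.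
Proof.
move=> w0 wL; have [x s0 xA] := lambda1_eigenvector R adjE f2 G_gt0.
rewrite -(ler_pM2r s0).
have -> : lambda1 * \sum_u x u ^+ 2 = \sum_u 2 * (x u * x (f u)).
  transitivity (\sum_u x u * (x (f u) + \sum_(v | f v == u) x v)).
    by rewrite mulr_sumr; apply: eq_bigr => u _; rewrite xA; ring.
  under eq_bigr do rewrite mulrDr mulr_sumr.
  rewrite big_split /= (sum_over_children f (fun u v => x u * x v)).
  rewrite -big_split /=.
  by apply: eq_bigr => u _; ring.
apply: (@le_trans _ _
  (\sum_u (w (f u) / w u * x u ^+ 2 + w u / w (f u) * x (f u) ^+ 2))).
  apply: ler_sum => u _; have wu := w0 u; have wf := w0 (f u).
  have -> : w (f u) / w u * x u ^+ 2 + w u / w (f u) * x (f u) ^+ 2 =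
      2 * (x u * x (f u)) +
      (w (f u) * x u - w u * x (f u)) ^+ 2 / (w u * w (f u)).
    by field; rewrite !gt_eqF.
  by rewrite lerDl divr_ge0 ?sqr_ge0 // mulr_ge0 // ltW.
rewrite big_split /= -(sum_over_children f (fun u v => w v / w u * x u ^+ 2)).
rewrite -big_split /= mulr_sumr; apply: ler_sum => u _.
rewrite -!mulr_suml -mulrDl -mulrDl ler_wpM2r ?sqr_ge0 //.
by rewrite ler_pdivrMr.
Qed.

Lemma lambda1_family x0 (vs : seq G) (s : nat -> nat) (w : nat -> R) L :
  uniq vs -> (forall v, v \in vs) ->
  (forall i, (i < size vs)%N -> index (f (nth x0 vs i)) vs = s i) ->
  (forall i, (i < size vs)%N -> 0 < w i) ->
  (forall k, (k < size vs)%N ->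
     w (s k) + \sum_(0 <= i < size vs | s i == k) w i <= L * w k) ->
  lambda1 <= L.
Proof.
move=> vs_uniq vsT f_vs w0 wL; apply: (@lambda1_le (fun v => w (index v vs))).
  by move=> u; rewrite w0 // index_mem.
move=> u; have uvs := vsT u.
have -> : \sum_(v | f v == u) w (index v vs) =
    \sum_(0 <= i < size vs | s i == index u vs) w i.
  rewrite big_mkcond (@sum_family R G x0 vs vs_uniq
    (fun v => if f v == u then w (index v vs) else 0)); last first.
    by move=> v; rewrite vsT.
  rewrite [RHS]big_mkcond; apply: eq_big_nat => i /andP[_ ni].
  rewrite index_uniq // -f_vs //; congr (if _ then _ else _).
  by apply/eqP/eqP => [->//|]; apply: index_inj; rewrite ?vsT.
have := wL (index u vs); rewrite index_mem uvs => /(_ isT).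
by rewrite -f_vs ?index_mem // nth_index.
Qed.

End CollatzBound.

(** * Edge weights on a long path *)

Section PathBound.
Variables (R : realType).

Lemma sum_square_progression (a : R) m :
  \sum_(0 <= k < m) (a - 2 * k%:R) ^+ 2 =
  m%:R * a ^+ 2 - 2 * a * (m%:R * (m%:R - 1)) +
    4 * (m%:R * (m%:R - 1) * (2 * m%:R - 1) / 6).
Proof.
elim: m => [|m IHm]; first by rewrite big_geq //; ring.
by rewrite big_nat_recr //= IHm -natr1; field.
Qed.

Lemma sum_square_parabola (b : R) m :
  \sum_(0 <= k < m) ((k%:R + 1) * (b - (k%:R + 1))) ^+ 2 =
  b ^+ 2 * (m%:R * (m%:R + 1) * (2 * m%:R + 1) / 6)
  - 2 * b * (m%:R ^+ 2 * (m%:R + 1) ^+ 2 / 4)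
  + m%:R * (m%:R + 1) * (2 * m%:R + 1) * (3 * m%:R ^+ 2 + 3 * m%:R - 1) / 30.
Proof.
elim: m => [|m IHm]; first by rewrite big_geq //; field.
by rewrite big_nat_recr //= IHm -natr1; field.
Qed.

(** The best weights on the edges of a path are a sine wave with alternating
signs. Replacing the sine by the parabola (i + 1) (n - 1 - i) loses little and
gives a rational quotient. In an orbit of size n whose tail has length p, the
last edge closes the cycle; the parabola vanishes on it, so only the path
formed by the other edges counts. *)
Lemma path_quotient n p (q : R) : (1 < n)%N -> (0 < p < n)%N ->
  let y i : R := (-1) ^+ i * ((i%:R + 1) * (n%:R - (i%:R + 1))) in
  q * \sum_(0 <= i < n) y i ^+ 2 <=
   \sum_(0 <= k < n) (y k +
       \sum_(0 <= i < n | (if i == n.-1 then p else i.+1) == k) y i) ^+ 2 ->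
  q * (n%:R ^+ 2 + 1) <= 10.
Proof.
move=> n1 /andP[p0 pn] y; have y_last : y n.-1 = 0.
  by rewrite /y natr1 prednK ?(ltnW n1) // subrr !mulr0.
have -> : \sum_(0 <= i < n) y i ^+ 2 = n%:R * (n%:R ^+ 4 - 1) / 30.
  under eq_bigr do rewrite /y exprMn -exprM mulnC exprM sqrrN !expr1n mul1r.
  by rewrite sum_square_parabola; field.
have -> : \sum_(0 <= k < n) (y k +
       \sum_(0 <= i < n | (if i == n.-1 then p else i.+1) == k) y i) ^+ 2 =
    n%:R * (n%:R ^+ 2 - 1) / 3.
  transitivity (\sum_(0 <= k < n) ((n%:R - 1) - 2 * k%:R : R) ^+ 2); last first.
    by rewrite sum_square_progression; field.
  apply: eq_big_nat => k /andP[_ kn].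
  have -> : \sum_(0 <= i < n | (if i == n.-1 then p else i.+1) == k) y i =
     if k is k'.+1 then y k' else 0.
    case: k kn => [|k] kn.
      by rewrite big1 // => i; case: ifP => _ /eqP pE; move: p0; rewrite ?pE.
    rewrite big_mkcond (bigD1_seq k) ?mem_index_iota ?iota_uniq //=;
      last exact: ltnW.
    have -> : (k == n.-1) = false by apply: ltn_eqF; move: kn; clear; lia.
    rewrite eqxx big1 ?addr0 // => i ik.
    case: (altP (i =P n.-1)) => [->|_]; first by rewrite y_last if_same.
    by rewrite eqSS (negPf ik).
  transitivity (((-1) ^+ k * ((n%:R - 1) - 2 * k%:R) : R) ^+ 2); last first.
    by rewrite exprMn -exprM mulnC exprM sqrrN !expr1n mul1r.
  congr (_ ^+ 2); case: k kn => [|k] kn; rewrite /y.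
    by rewrite expr0; ring.
  by rewrite exprS -natr1; ring.
have n0 : 1 < n%:R :> R by rewrite (ltr_nat R 1).
have pos : 0 < n%:R * (n%:R ^+ 2 - 1) / 30 :> R.
  apply: divr_gt0 => //; apply: mulr_gt0; first by lra.
  by rewrite subr_gt0 exprn_egt1.
move=> h; rewrite -(ler_pM2r pos); move: h; lra.
Qed.

End PathBound.

(** * The parent map of a connected unicyclic graph *)

Section Walks.
Variable H : sgraph.
Implicit Types (x y z : H).

Definition walk k x y :=
  exists p, [/\ path (@adj H) x p, last x p = y & size p = k].

Lemma walk_cons x y z k : adj x y -> walk k y z -> walk k.+1 x z.
Proof. by move=> xy [p [pp pl ps]]; exists (y :: p); rewrite /= xy pp ps. Qed.

Lemma walk_cat k l x y z : walk k x y -> walk l y z -> walk (k + l) x z.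
Proof.
move=> [p [pp pl ps]] [q [qp ql qs]]; exists (p ++ q).
by rewrite cat_path last_cat size_cat pp pl qp ql ps qs.
Qed.

Lemma walk_sym k x y : walk k x y -> walk k y x.
Proof.
move=> [p [pp pl ps]]; exists (rev (belast x p)); split.
- by rewrite -pl rev_path; under eq_path do rewrite adj_sym.
- by rewrite -pl; case: (p) => //= a s; rewrite rev_cons last_rcons.
- by rewrite size_rev size_belast.
Qed.

(** When k is at least the number of vertices the bound holds because the
search defining the distance stops there. *)
Lemma dist_walk k x y : walk k x y -> (dist x y <= k)%N.
Proof.
move=> [p [pp pl ps]]; rewrite /dist; set a := (X in find X _).
have := find_size a (iota 0 #|H|); rewrite size_iota => fH.
have [Hk|kH] := leqP #|H| k; first exact: leq_trans fH Hk.
rewrite leqNgt; apply/negP => /(before_find 0).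
rewrite nth_iota // add0n => /existsP[]; have/eqP tp := ps.
by exists (Tuple tp); rewrite /= pp pl eqxx.
Qed.

Lemma diam_le d : (forall x y, (dist x y <= d)%N) -> (diam H <= d)%N.
Proof. by move=> h; apply/bigmax_leqP => x _; apply/bigmax_leqP => y _. Qed.

End Walks.

Section UnicyclicParent.
Variables (G : sgraph) (c : seq G).
Hypothesis hG : connected_unicyclic G.
Hypothesis hc : is_cycle c.

Let c_cycle : cycle (@adj G) c. Proof. by case/andP: hc => /andP[]. Qed.
Let c_uniq : uniq c. Proof. by case/andP: hc => /andP[]. Qed.
Let c_size : (2 < size c)%N. Proof. by case/andP: hc. Qed.

Lemma next_next_neq v : v \in c -> next c (next c v) != v.
Proof.
move=> vc; have [i s cE] := rot_to vc.
have nE : next c =1 next (v :: s) by move=> x; rewrite -cE next_rot.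
rewrite !nE.
have : uniq (v :: s) by rewrite -cE rot_uniq.
have : (2 < size (v :: s))%N by rewrite -cE size_rot.
case: s {cE nE} => [|w [|x s]] //= _; rewrite !inE !negb_or.
case/andP=> /and3P[vw vx _] _.
by rewrite /next /= eqxx [w == v]eq_sym (negPf vw) eqxx eq_sym.
Qed.

Lemma exists_level v :
  exists k, [exists p : k.-tuple G, path (@adj G) v p && (last v p \in c)].
Proof.
have [[_ conG] _] := hG.
have : head v c \in c by case: (c) c_size => //= a s _; rewrite mem_head.
move: (head v c) => w wc; have /connectP[p pp wE] := conG v w.
by exists (size p); apply/existsP; exists (in_tuple p); rewrite pp -wE.
Qed.

Definition level v := ex_minn (exists_level v).

Lemma level_eq0 v : (level v == 0%N) = (v \in c).
Proof.
rewrite /level; case: ex_minnP => k /existsP[p /andP[pp pl]] kmin.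
apply/eqP/idP => [k0|vc].
  by move: p pp pl; rewrite k0 => p; rewrite tuple0.
have := kmin 0%N; rewrite leqn0 => h; apply/eqP/h.
by apply/existsP; exists [tuple].
Qed.

Lemma exists_up v : v \notin c ->
  exists w, adj v w && ((level w).+1 == level v).
Proof.
rewrite -level_eq0 {1 3}/level; case: ex_minnP => -[//|k].
case/existsP => p; case/tupleP: p => w p /= /andP[/andP[vw pp] pl] kmin _.
exists w; rewrite vw /= eqSS eqn_leq; apply/andP; split; rewrite /level.
  case: ex_minnP => m _ mmin; apply: mmin.
  by apply/existsP; exists p; rewrite pp.
case: ex_minnP => m /existsP[q /andP[qp ql]] _.
rewrite -ltnS; apply: kmin; apply/existsP; exists [tuple of w :: q].
by rewrite /= vw qp.
Qed.

(** On the cycle the parent is the successor, elsewhere a neighbour closer to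
the cycle, so the forward orbit of a vertex at level p is a path of length p
followed by the whole cycle. *)
Definition parent v :=
  if v \in c then next c v
  else odflt v [pick w | adj v w && ((level w).+1 == level v)].

Lemma parent_cycle v : v \in c -> parent v = next c v.
Proof. by rewrite /parent => ->. Qed.

Lemma fcycle_parent : fcycle parent c.
Proof.
have := cycle_next c_uniq.
rewrite (eq_in_cycle (P := mem c) (e' := frel parent)) //.
by move=> x y xc _ /=; rewrite parent_cycle.
Qed.

Lemma parent_off v : v \notin c ->
  adj v (parent v) /\ level v = (level (parent v)).+1.
Proof.
move=> vc; rewrite /parent (negPf vc).
case: pickP => /= [w /andP[vw /eqP->]//|].
by have [w vw] := exists_up vc; move/(_ w); rewrite vw.
Qed.

Lemma adj_parent v : adj v (parent v).
Proof.
have [vc|vc] := boolP (v \in c); last by have [] := parent_off vc.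
by rewrite parent_cycle // next_cycle.
Qed.

Lemma parent_parent v : parent (parent v) != v.
Proof.
have [vc|vc] := boolP (v \in c).
  by rewrite (parent_cycle vc) parent_cycle ?mem_next // next_next_neq.
have [_ lv] := parent_off vc.
have [pc|pc] := boolP (parent v \in c).
  apply: contraNneq vc => <-; by rewrite (parent_cycle pc) mem_next.
apply/negP => /eqP ppv; have [_] := parent_off pc; rewrite ppv; lia.
Qed.

(** Suppose an edge uv is not of the form {x, parent x}. Following parents
never uses it, so the graph without uv is still connected; a path from v to u
in it closes up with uv to a cycle through uv. By uniqueness uv is then an edge
of c, that is, a pair {x, next c x} = {x, parent x}. *)
Lemma adj_parentE u v : adj u v = (parent u == v) || (parent v == u).
Proof.
apply/idP/orP => [uv|[]/eqP<-];
  [|exact: adj_parent|by rewrite adj_sym adj_parent].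
apply/orP; apply/negPn/negP; rewrite negb_or => /andP[puv pvu].
have neq_edge x : [set x; parent x] != [set u; v].
  apply/eqP => xE.
  have : u \in [set x; parent x] by rewrite xE set21.
  have : v \in [set x; parent x] by rewrite xE set22.
  have uNv : u != v by apply: contraTneq uv => ->; rewrite adj_irrefl.
  rewrite !inE => /pred2P[]vE /pred2P[]uE; move: uNv puv pvu;
    by rewrite vE uE ?eqxx.
pose r x y := adj x y && ([set x; y] != [set u; v]).
have r_sym : symmetric r by move=> x y; rewrite /r adj_sym finset.setUC.
have r_parent x : connect r x (parent x).
  by apply: connect1; rewrite /r adj_parent neq_edge.
have r_iter k x : connect r x (iter k parent x).
  elim: k => [|k IHk] /=; first exact: connect0.
  exact: connect_trans IHk (r_parent _).
have r_c x : exists2 w, w \in c & connect r x w.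
  have [k] := ubnP (level x); elim: k x => // k IHk x xk.
  have [xc|xc] := boolP (x \in c); first by exists x; rewrite ?connect0.
  have [_ lx] := parent_off xc; have [|w wc xw] := IHk (parent x); first by lia.
  by exists w => //; apply: connect_trans xw.
have c_conn x y : x \in c -> y \in c -> connect r x y.
  move=> xc yc; have : fconnect parent x y.
    by rewrite (fconnect_cycle fcycle_parent).
  by move=> /iter_findex <-.
have : connect r v u.
  have [w wc vw] := r_c v; have [w' wc' uw'] := r_c u.
  apply: connect_trans vw _; apply: connect_trans (c_conn _ _ wc wc') _.
  by rewrite (sym_connect_sym r_sym).
case/connectP => p0 p0P uE; case/shortenP: p0P uE => p pp p_uniq _ uE.
have padj : path (@adj G) v p by apply: sub_path pp => a b /andP[].
have cyc : is_cycle (v :: p).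
  rewrite /is_cycle /ucycleb p_uniq andbT /= rcons_path padj -uE uv /=.
  case: p pp uE {p_uniq padj} => [|a [|b p]] //=.
    by move=> _ uv'; move: uv; rewrite uv' adj_irrefl.
  by rewrite /r andbT => /andP[_ /eqP h] ua; case: h; rewrite ua finset.setUC.
have [_ [E [_ Euniq]]] := hG.
have : cycle_edges (v :: p) = cycle_edges c.
  have cycE d : is_cycle d -> E = cycle_edges d.
    by move=> dc; apply: Euniq; exists d.
  by rewrite -(cycE _ cyc) -(cycE _ hc).
have : [set u; v] \in cycle_edges (v :: p).
  apply/imsetP; exists u; first by rewrite uE mem_last.
  have -> // : next (v :: p) u = v.
  by rewrite uE next_nth mem_last index_last // nth_default.
move=> h1 h2; move: h1; rewrite h2 => /imsetP[x xc xE].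
by have := neq_edge x; rewrite parent_cycle // xE eqxx.
Qed.

End UnicyclicParent.

(** * Depth and diameter of the induced trees *)

Section InducedTrees.
Variables (G : sgraph) (c : seq G).
Hypothesis hG : connected_unicyclic G.
Hypothesis hc : is_cycle c.

Local Notation f := (parent hG hc).
Local Notation lev := (level hG hc).

Let c_uniq : uniq c. Proof. by case/andP: hc => /andP[]. Qed.
Let c_size : (2 < size c)%N. Proof. by case/andP: hc. Qed.

Definition root_of v := iter (lev v) f v.

Lemma level_iter k v : (k <= lev v)%N -> lev (iter k f v) = (lev v - k)%N.
Proof.
elim: k => [|k IHk] kv /=; first by rewrite subn0.
have lk := IHk (ltnW kv).
have /(parent_off hG hc)[_] : iter k f v \notin c.
  by rewrite -(level_eq0 hG hc) lk; lia.
by rewrite lk => e; apply/eqP; rewrite -eqSS -e subnSK.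
Qed.

Lemma root_of_cycle v : root_of v \in c.
Proof. by rewrite -(level_eq0 hG hc) level_iter // subnn. Qed.

Lemma root_of_parent v : v \notin c -> root_of (f v) = root_of v.
Proof. by move=> /(parent_off hG hc)[_ lv]; rewrite /root_of lv iterSr. Qed.

Lemma root_of_id v : v \in c -> root_of v = v.
Proof. by rewrite /root_of -(level_eq0 hG hc) => /eqP->. Qed.

Lemma tree_adj v : v \notin c -> @adj (del_edges (cycle_edges c)) v (f v).
Proof.
move=> vc; rewrite /= /del_edges_rel (adj_parent hG hc) /=.
apply: contra vc => /imsetP[x xc xE].
have : v \in [set x; next c x] by rewrite -xE set21.
by rewrite !inE => /pred2P[]->; rewrite ?mem_next.
Qed.

Lemma tree_adj_root x y :
  @adj (del_edges (cycle_edges c)) x y -> root_of x = root_of y.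
Proof.
suff up a b : f a = b -> [set a; b] \notin cycle_edges c ->
    root_of a = root_of b.
  rewrite /= /del_edges_rel (adj_parentE hG hc).
  case/andP=> /orP[/eqP xy|/eqP yx] nE.
    exact: up.
  by apply/esym/up; rewrite 1?finset.setUC.
move=> <- abE; rewrite root_of_parent //; apply: contra abE => ac.
by apply/imsetP; exists a; rewrite ?parent_cycle.
Qed.

Lemma component_root u (X : induced_tree c u) : u \in c -> root_of (val X) = u.
Proof.
move=> uc; have /connectP[p pp ->] := valP X; rewrite -[RHS]root_of_id //.
by elim: p u {X uc} pp => //= y p IHp x /andP[/tree_adj_root-> /IHp].
Qed.

Lemma walk_up u (X : induced_tree c u) k : (k <= lev (val X))%N ->
  exists2 Y : induced_tree c u, val Y = iter k f (val X) & walk k X Y.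
Proof.
elim: k X => [|k IHk] X kX; first by exists X => //; exists [::].
have Xc : val X \notin c by rewrite -(level_eq0 hG hc); case: (lev _) kX.
have uY : connect (@adj (del_edges (cycle_edges c))) u (f (val X)).
  by apply: connect_trans (valP X) _; apply: connect1; apply: tree_adj.
have [_ lX] := parent_off hG hc Xc.
have [|Y YE XY] := IHk (Sub (f (val X)) uY : induced_tree c u).
  by rewrite /= -ltnS -lX.
exists Y; first by rewrite YE /= -iterSr.
by apply: walk_cons XY; apply: tree_adj.
Qed.

Lemma dist_up u (X Y : induced_tree c u) k l :
  (k <= lev (val X))%N -> (l <= lev (val Y))%N ->
  iter k f (val X) = iter l f (val Y) -> (dist X Y <= k + l)%N.
Proof.
move=> /walk_up[Z ZE XZ] /walk_up[W WE YW] ZW.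
apply: dist_walk; apply: walk_cat XZ _.
have -> : Z = W by apply: val_inj; rewrite ZE WE.
exact: walk_sym.
Qed.

Lemma diam_tree_le u p : u \in c ->
  (forall x, root_of x = u -> (lev x <= p)%N) ->
  (diam (induced_tree c u) <= 2 * p)%N.
Proof.
move=> uc xp; apply: diam_le => X Y.
apply: leq_trans (dist_up (leqnn _) (leqnn _) _) _; last first.
  by rewrite mul2n -addnn leq_add // xp ?component_root.
by rewrite -!/(root_of _) !component_root.
Qed.

(** If the root has a single child t, two vertices other than the root are
joined by a walk through t, which saves two edges. *)
Lemma diam_tree_one_branch u p t : u \in c ->
  (forall x, root_of x = u -> (lev x <= p)%N) ->
  (forall v, v \notin c -> f v = u -> v = t) ->
  (diam (induced_tree c u) <= maxn p (2 * p - 2))%N.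
Proof.
move=> uc xp one; apply: diam_le => X Y.
have XYp (Z : induced_tree c u) : (lev (val Z) <= p)%N.
  by rewrite xp ?component_root.
have [lX|lX] := posnP (lev (val X)).
  apply: leq_trans (@dist_up _ X Y 0 (lev (val Y)) _ _ _) _ => //.
    rewrite -!/(root_of _) component_root //= -[RHS](component_root X uc).
    by rewrite root_of_id // -(level_eq0 hG hc) lX.
  by rewrite add0n leq_max XYp.
have [lY|lY] := posnP (lev (val Y)).
  apply: leq_trans (@dist_up _ X Y (lev (val X)) 0 _ _ _) _ => //.
    rewrite -!/(root_of _) component_root //= -[LHS](component_root Y uc).
    by rewrite root_of_id // -(level_eq0 hG hc) lY.
  by rewrite addn0 leq_max XYp.
have top (Z : induced_tree c u) : (0 < lev (val Z))%N ->
    iter (lev (val Z)).-1 f (val Z) = t.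
  move=> lZ; apply: one.
    by rewrite -(level_eq0 hG hc) level_iter ?leq_pred //; lia.
  by rewrite -iterS prednK // -/(root_of _) component_root.
apply: leq_trans (dist_up (leq_pred _) (leq_pred _) _) _; first by rewrite !top.
have := XYp X; have := XYp Y; rewrite leq_max; lia.
Qed.

Lemma max_tree_diam_attained :
  exists2 u, u \in c & (max_tree_diam c <= diam (induced_tree c u))%N.
Proof.
rewrite /max_tree_diam; set F := fun v => diam (induced_tree c v).
have : c != [::] by case: (c) c_size.
suff h (s : seq G) : s != [::] ->
    exists2 u, u \in s & (\max_(v <- s) F v <= F u)%N.
  exact: h.
elim: s => // a [|b s] IHs _.
  by exists a; rewrite ?mem_head // big_seq1.
have [//|u us uF] := IHs; rewrite big_cons.
have [ua|au] := leqP (F u) (F a).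
  by exists a; rewrite ?mem_head // geq_max leqnn (leq_trans uF).
by exists u; [rewrite in_cons us orbT|rewrite geq_max (ltnW au)].
Qed.

Lemma deepest_vertex u x0 : root_of x0 = u ->
  exists2 t, root_of t = u & forall x, root_of x = u -> (lev x <= lev t)%N.
Proof.
move=> x0u; have x0P : root_of x0 == u by apply/eqP.
case: (@arg_maxnP _ x0 (fun x => root_of x == u) lev x0P) => t /eqP tu tmax.
by exists t => // x /eqP/tmax.
Qed.

(** The vertex t is a deepest one of a tree of largest diameter. Should that
tree be a single vertex, the bounds on the diameter are trivial and t is taken
in the tree of x0 instead. The alternative is whether the root of the tree of t
has a second child. *)
Lemma deep_branch x0 : x0 \notin c -> exists t,
  [/\ (0 < lev t)%N, forall x, root_of x = root_of t -> (lev x <= lev t)%N &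
   (max_tree_diam c <= 2 * lev t)%N /\
   ((exists t',
      [/\ t' \notin c, f t' = root_of t & t' != iter (lev t).-1 f t]) \/
   (forall v, v \notin c -> f v = root_of t -> v = iter (lev t).-1 f t) /\
   (max_tree_diam c <= maxn (lev t) (2 * lev t - 2))%N)].
Proof.
move=> x0c; have [u uc hu] := max_tree_diam_attained.
have [w [wc hw]] : exists w, w \notin c /\
    (root_of w = u \/ max_tree_diam c = 0%N).
  case: (pickP (fun w => (w \notin c) && (root_of w == u)))
    => [w /andP[wc /eqP wu]|none].
    by exists w; split=> //; left.
  exists x0; split=> //; right; apply/eqP; rewrite -leqn0.
  apply: leq_trans hu _; apply: leq_trans (diam_tree_le (p := 0) uc _) _ => //.
  move=> x xu; rewrite leqn0 (level_eq0 hG hc).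
  by have := none x; rewrite xu eqxx andbT => /negbFE.
have [t tw tmax] := deepest_vertex (erefl (root_of w)).
have t0 : (0 < lev t)%N.
  by apply: leq_trans (tmax w erefl); rewrite lt0n (level_eq0 hG hc).
exists t; rewrite tw; split=> //; split.
  case: hw => [wu|->//]; apply: leq_trans hu _.
  by apply: diam_tree_le => // x xu; apply: tmax; rewrite wu.
case: (pickP (fun v => [&& v \notin c, f v == root_of w
    & v != iter (lev t).-1 f t])).
  by move=> t' /and3P[tc /eqP ft tt]; left; exists t'.
move=> none; right.
have one v : v \notin c -> f v = root_of w -> v = iter (lev t).-1 f t.
  by move=> vc vw; have := none v; rewrite vc vw eqxx /= => /negbFE/eqP.
split=> //; case: hw => [wu|->//]; apply: leq_trans hu _.
apply: (@diam_tree_one_branch _ _ (iter (lev t).-1 f t)) => //.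
  by move=> x xu; apply: tmax; rewrite wu.
by move=> v vc vu; apply: one; rewrite ?wu.
Qed.

Lemma cycle_order u : u \in c -> order f u = size c.
Proof. exact: (order_cycle (fcycle_parent hG hc) c_uniq). Qed.

Lemma iter_cycle k u : u \in c -> iter k f u \in c.
Proof. by move=> uc; elim: k => //= k IHk; rewrite parent_cycle ?mem_next. Qed.

Lemma iter_size_cycle u : u \in c -> iter (size c) f u = u.
Proof.
move=> uc; rewrite -(cycle_order uc).
exact: (iter_order_cycle (fcycle_parent hG hc)).
Qed.

Lemma cycle_traject_uniq u : u \in c -> uniq (traject f u (size c)).
Proof. by move=> uc; rewrite -(cycle_order uc); exact: orbit_uniq. Qed.

Lemma mem_cycle_traject u : u \in c -> c =i traject f u (size c).
Proof.
move=> uc x; rewrite -(cycle_order uc).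
rewrite -[RHS]/(x \in orbit f u) -fconnect_orbit.
by rewrite (fconnect_cycle (fcycle_parent hG hc)).
Qed.

Lemma orbit_traject_uniq t : uniq (traject f t (lev t + size c)).
Proof.
rewrite trajectD cat_uniq cycle_traject_uniq ?root_of_cycle // andbT.
apply/andP; split.
  apply/(uniqP t) => i j; rewrite !inE size_traject => it jt.
  rewrite (nth_traject f it) (nth_traject f jt) => /(congr1 lev).
  rewrite (level_iter (ltnW it)) (level_iter (ltnW jt)).
  by move: it jt; clear; lia.
apply/hasPn => x; rewrite -mem_cycle_traject ?root_of_cycle // => xc.
apply/trajectP => -[i it xE]; move: xc.
by rewrite xE -(level_eq0 hG hc) (level_iter (ltnW it)) subn_eq0 leqNgt it.
Qed.

(** The last vertex of the orbit closes the cycle, at position lev t. *)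
Lemma orbit_index t i : (i < lev t + size c)%N ->
  let n := (lev t + size c)%N in
  index (f (nth t (traject f t n) i)) (traject f t n) =
    if i == n.-1 then lev t else i.+1.
Proof.
move=> it n; rewrite nth_traject // -iterS.
have [->|ne] := eqVneq i n.-1.
  have ln : (lev t < n)%N by rewrite /n; move: c_size; clear; lia.
  rewrite prednK ?(leq_trans _ ln) // /n addnC iterD.
  rewrite iter_size_cycle ?root_of_cycle // addnC -/n -(nth_traject f ln).
  by rewrite index_uniq ?orbit_traject_uniq // size_traject.
have i1 : (i.+1 < n)%N by move: it ne; rewrite -/n; clear; lia.
rewrite -(nth_traject f i1).
by rewrite index_uniq ?orbit_traject_uniq // size_traject.
Qed.

End InducedTrees.

(** * Test vectors on orbits and on arcs of the cycle *)

Section Bounds.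
Variables (R : realType) (G : sgraph) (c : seq G).
Hypothesis hG : connected_unicyclic G.
Hypothesis hc : is_cycle c.

Local Notation f := (parent hG hc).
Local Notation lev := (level hG hc).
Local Notation g := (size c).
Local Notation lambda1 := (eig_max (adj_mx R G)).
Local Notation lambdan := (eig_min (adj_mx R G)).
Local Notation q1 := (eig_max (signless_laplacian R G)).
Local Notation qn := (eig_min (signless_laplacian R G)).

Let fE := adj_parentE hG hc.
Let f2 := parent_parent hG hc.
Let G_gt0 : (0 < #|G|)%N. Proof. by have [[]] := hG. Qed.
Let c_size : (2 < g)%N. Proof. by case/andP: hc. Qed.

(** How the hypothesis on lambdan is used: it gives
lambda1 - lambdan <= 2 lambda1 - (1 - cos (pi / (D0 + 1))), so that any
nu <= q1 - 2 lambda1 leaves the bound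
nu + 1 - cos (pi / (D0 + 1)) to be met by qn. *)
Definition least_eigenvalue_bound : Prop :=
  1 - cos (pi / ((g%:R + 1) / 2 + (max_tree_diam c)%:R + 1)) - lambda1
    <= lambdan.

Lemma spread_by_gap (U nu : R) : least_eigenvalue_bound ->
  nu <= q1 - 2 * lambda1 -> qn <= U -> U <= nu -> spread R G <= q1 - qn.
Proof.
rewrite /least_eigenvalue_bound /spread.
have := @cos_le1 R (pi / ((g%:R + 1) / 2 + (max_tree_diam c)%:R + 1)).
by move: (cos _) lambda1 lambdan q1 qn => a l1 ln q q' *; lra.
Qed.

Lemma spread_by_diameter (U nu : R) (D : nat) : least_eigenvalue_bound ->
  nu <= q1 - 2 * lambda1 -> qn <= U ->
  (g + 3 + 2 * max_tree_diam c <= 2 * D)%N ->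
  U <= nu + (4926 / 1000 / D%:R ^+ 2 - 405 / 100 / D%:R ^+ 4) ->
  spread R G <= q1 - qn.
Proof.
rewrite /least_eigenvalue_bound /spread => hyp gap qnU gD.
have D1 : 2 <= (g%:R + 1) / 2 + (max_tree_diam c)%:R + 1 :> R.
  have : 3 <= g%:R :> R by rewrite (ler_nat R 3).
  have : 0 <= (max_tree_diam c)%:R :> R by rewrite ler0n.
  by clear hyp gap qnU => *; lra.
have D2 : (g%:R + 1) / 2 + (max_tree_diam c)%:R + 1 <= D%:R :> R.
  by clear hyp gap qnU; move: gD; rewrite -(ler_nat R) !natrD => *; lra.
have := one_sub_cos_pi_div_ge D1 D2; move: hyp gap qnU.
move: (cos _) (_ - _ / _ ^+ 4) lambda1 lambdan q1 qn => a b l1 ln q q' *.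
by lra.
Qed.

Lemma orbit_vertex t p : (p <= lev t)%N -> exists t', lev t' = p.
Proof.
move=> pt; exists (iter (lev t - p) f t).
by rewrite level_iter ?leq_subr // subKn.
Qed.

(** Quantifying over q keeps the numerical sums apart from the eigenvalue they
bound. *)
Lemma qn_orbit p t (y : nat -> R) U n : (p <= lev t)%N -> n = (p + g)%N ->
  (forall q : R, q * \sum_(0 <= i < n) y i ^+ 2 <=
     \sum_(0 <= k < n) (y k +
       \sum_(0 <= i < n | (if i == n.-1 then p else i.+1) == k) y i) ^+ 2 ->
     q <= U) ->
  qn <= U.
Proof.
move=> pt nE; apply; have [t' lt'] := orbit_vertex pt.
have nE' : n = (lev t' + g)%N by rewrite nE lt'.
have := @edge_family R G f fE f2 G_gt0 t' (traject f t' n)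
  (fun i => if i == n.-1 then p else i.+1).
rewrite size_traject; apply.
- by rewrite nE'; exact: orbit_traject_uniq.
- by move=> i ni; rewrite nE' -lt' in ni *; exact: orbit_index.
- move=> i ni; case: eqP => [_|ne].
    by rewrite nE; move: c_size; clear; lia.
  by move/eqP: ne ni; clear; lia.
Qed.

Lemma q1_orbit p t (z : nat -> R) q0 n : (p <= lev t)%N -> n = (p + g)%N ->
  z n = 0 ->
  (forall q : R,
     \sum_(0 <= i < n) (z i + z (if i == n.-1 then p else i.+1)) ^+ 2 <=
     q * \sum_(0 <= i < n) z i ^+ 2 -> q0 <= q) ->
  q0 <= q1.
Proof.
move=> pt nE zn; apply; have [t' lt'] := orbit_vertex pt.
have nE' : n = (lev t' + g)%N by rewrite nE lt'.
have := @signless_family R G f fE f2 t' (traject f t' n)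
  (fun i => if i == n.-1 then p else i.+1).
rewrite size_traject; apply=> //.
- by rewrite nE'; exact: orbit_traject_uniq.
- by move=> i ni; rewrite nE' -lt' in ni *; exact: orbit_index.
Qed.

Lemma arc_uniq w m : w \in c -> (m <= g)%N -> uniq (traject f w m).
Proof.
move=> wc mg; have := cycle_traject_uniq hG hc wc.
by rewrite -(subnKC mg) trajectD cat_uniq => /and3P[].
Qed.

(** The vertices used below form an arc of the cycle preceded by a list L of
vertices off the cycle. *)
Lemma branch_uniq L w m : w \in c -> (m <= g)%N -> uniq L ->
  all [predC c] L -> uniq (L ++ traject f w m).
Proof.
move=> wc mg uL Lc; rewrite cat_uniq uL arc_uniq // andbT.
apply/hasPn => x /trajectP[i im ->]; apply/negP => /(allP Lc) /=.
by rewrite iter_cycle.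
Qed.

(** For i = m < g the vertex lies just past the arc and the index is the length
of the list. *)
Lemma branch_index L w m i : w \in c -> (m <= g)%N -> all [predC c] L ->
  (i < m)%N || (i == m) && (m < g)%N ->
  index (iter i f w) (L ++ traject f w m) = (size L + i)%N.
Proof.
move=> wc mg Lc im; rewrite index_cat ifN; last first.
  by apply/negP => /(allP Lc) /=; rewrite iter_cycle.
congr (_ + _)%N; case/orP: im => [im|/andP[/eqP-> mg']].
  by rewrite -(nth_traject f im) index_uniq ?arc_uniq // size_traject.
rewrite memNindex ?size_traject //.
by have := arc_uniq wc mg'; rewrite trajectSr rcons_uniq => /andP[].
Qed.

End Bounds.

Section BranchVectors.
Variables (R : realType) (G : sgraph) (c : seq G).
Hypothesis hG : connected_unicyclic G.
Hypothesis hc : is_cycle c.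

Local Notation f := (parent hG hc).
Local Notation lev := (level hG hc).
Local Notation g := (size c).
Local Notation lambda1 := (eig_max (adj_mx R G)).
Local Notation q1 := (eig_max (signless_laplacian R G)).
Local Notation qn := (eig_min (signless_laplacian R G)).

Let fE := adj_parentE hG hc.
Let f2 := parent_parent hG hc.
Let G_gt0 : (0 < #|G|)%N. Proof. by have [[]] := hG. Qed.

(** The bound decreases with the length of the path, so n may be any number up
to the size p + g of the orbit. *)
Lemma qn_path n t p U : (0 < p <= lev t)%N -> (1 < n <= p + g)%N ->
  10 <= U * (n%:R ^+ 2 + 1) -> qn <= U.
Proof.
case/andP=> p0 pt /andP[n1 npg].
have N1 : (1 < p + g)%N := leq_trans n1 npg.
have c3 : (2 < g)%N by case/andP: hc.
have pos m : 0 < m%:R ^+ 2 + 1 :> R by rewrite ltr_wpDl ?sqr_ge0.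
suff : qn <= 10 / ((p + g)%:R ^+ 2 + 1).
  move=> qn_le; rewrite -ler_pdivrMr // => /(le_trans _); apply.
  apply: le_trans qn_le _.
  rewrite ler_pM2l // lef_pV2 ?posrE ?pos // lerD2r.
  by rewrite lerXn2r ?nnegrE ?ler0n // ler_nat.
apply: (qn_orbit pt erefl
  (y := fun i => (-1) ^+ i * ((i%:R + 1) * ((p + g)%:R - (i%:R + 1))))) => q.
move/path_quotient; rewrite ler_pdivlMr //; apply=> //.
by rewrite p0 -[X in (X < _)%N]addn0 ltn_add2l (ltn_trans _ c3).
Qed.

Section TwoBranches.
Variables a b : G.
Hypotheses (ac : a \notin c) (bc : b \notin c) (ab : a != b).
Hypothesis fac : f a \in c.

Let Lc : all [predC c] [:: a; b]. Proof. by rewrite /= ac bc. Qed.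
Let Lu : uniq [:: a; b]. Proof. by rewrite /= inE ab. Qed.

Section Triangle.
Hypothesis g3 : g = 3%N.
Let vs := [:: a; b] ++ traject f (f a) 3.
Let vs_uniq : uniq vs.
Proof. by apply: branch_uniq; rewrite ?g3. Qed.
Let idx j : (j < 3)%N -> index (iter j f (f a)) vs = j.+2.
Proof. by move=> j3; rewrite /vs branch_index ?g3 // j3. Qed.
Let f3 : f (f (f (f a))) = f a.
Proof. by have := iter_size_cycle hG hc fac; rewrite g3. Qed.

Let index_f k s : (k < 3)%N -> f b = iter k f (f a) ->
  s = [:: 2; k.+2; 3; 4; 2]%N ->
  forall i, (i < size vs)%N -> index (f (nth a vs i)) vs = nth 0%N s i.
Proof.
move=> k3 fb ->; case=> [|[|[|[|[|//]]]]] _.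
- exact: (@idx 0).
- by rewrite -[f _]/(f b) fb idx.
- exact: (@idx 1).
- exact: (@idx 2).
- by rewrite -[f _]/(f (f (f (f a)))) f3; exact: (@idx 0).
Qed.

Lemma twin_triangle : f b = f a -> qn <= 103 / 323 /\ 644 / 121 <= q1.
Proof.
move=> fb; have idxf := @index_f 0 [:: 2; 2; 3; 4; 2]%N isT fb erefl; split.
- have s_lt i : (i < size vs)%N -> (nth 0%N [:: 2; 2; 3; 4; 2]%N i < size vs)%N.
    by case: i => [|[|[|[|[|]]]]].
  have := @edge_family R G f fE f2 G_gt0 a vs _ vs_uniq idxf
    (nth 0 [:: -9; -9; 12; -14; 12]) s_lt.
  by move: qn q1 => ? ?; rewrite unlock /=; lra.
- have := @signless_family R G f fE f2 a vs _ vs_uniq idxf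
    (nth 0 [:: 2; 2; 9; 4; 4]) erefl.
  by move: qn q1 => ? ?; rewrite unlock /=; lra.
Qed.

Lemma bull_triangle : f b = f (f a) -> qn <= 13 / 34 /\ 59 / 12 <= q1.
Proof.
move=> fb; have idxf := @index_f 1 [:: 2; 3; 3; 4; 2]%N isT fb erefl; split.
- have s_lt i : (i < size vs)%N -> (nth 0%N [:: 2; 3; 3; 4; 2]%N i < size vs)%N.
    by case: i => [|[|[|[|[|]]]]].
  have := @edge_family R G f fE f2 G_gt0 a vs _ vs_uniq idxf
    (nth 0 [:: -3; 3; 0; -5; 5]) s_lt.
  by move: qn q1 => ? ?; rewrite unlock /=; lra.
- have := @signless_family R G f fE f2 a vs _ vs_uniq idxf
    (nth 0 [:: 1; 1; 3; 3; 2]) erefl.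
  by move: qn q1 => ? ?; rewrite unlock /=; lra.
Qed.

End Triangle.

(** The weights are constant on the cycle, so that it does not matter where b
is attached. *)
Lemma two_pendants_pentagon : g = 5%N -> f b \in c -> 1169 / 259 <= q1.
Proof.
move=> g5 fbc; pose vs := [:: a; b] ++ traject f (f a) 5.
have vs_uniq : uniq vs by apply: branch_uniq; rewrite ?g5.
have idx j : (j < 5)%N -> index (iter j f (f a)) vs = j.+2.
  by move=> j5; rewrite /vs branch_index ?g5 // j5.
have f5 : iter 5 f (f a) = f a.
  by have := iter_size_cycle hG hc fac; rewrite g5.
have [k k5 fb] : exists2 k, (k < 5)%N & f b = iter k f (f a).
  by apply/trajectP; rewrite -g5 -mem_cycle_traject.
have idxf i : (i < size vs)%N ->
    index (f (nth a vs i)) vs = nth 0%N [:: 2; k.+2; 3; 4; 5; 6; 2]%N i.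
  case: i => [|[|[|[|[|[|[|//]]]]]]] _.
  - exact: (@idx 0).
  - by rewrite -[f _]/(f b) fb idx.
  - exact: (@idx 1).
  - exact: (@idx 2).
  - exact: (@idx 3).
  - exact: (@idx 4).
  - by rewrite -[f _]/(iter 5 f (f a)) f5; exact: (@idx 0).
have := @signless_family R G f fE f2 a vs _ vs_uniq idxf
  (nth 0 [:: 3; 3; 10; 10; 10; 10; 10]) erefl.
by case: k k5 {fb idxf} => [|[|[|[|[|//]]]]] _; move: qn q1 => ? ?;
  rewrite unlock /=; lra.
Qed.

(** The support is the hub f a, its two children a and b and its two
neighbours on the cycle; w, two steps before the hub, has weight 0 and is
listed for the edge that leaves it. *)
Lemma twin_long : (4 < g)%N -> f b = f a -> 994 / 194 <= q1.
Proof.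
move=> g5 fb; pose w := iter (g - 2) f (f a).
have wc : w \in c by rewrite iter_cycle.
have fw : f (f w) = f a.
  rewrite -[f (f w)]/(iter 2 f w) /w -iterD addnC subnK ?(leq_trans _ g5) //.
  exact: iter_size_cycle.
pose vs := [:: a; b] ++ traject f w 4.
have vs_uniq : uniq vs by apply: branch_uniq => //; exact: ltnW.
have idx j : (j < 5)%N -> index (iter j f w) vs = j.+2.
  move=> j5; rewrite /vs branch_index ?(ltnW g5) //.
  by rewrite g5 andbT orbC -leq_eqVlt.
have idxf i : (i < size vs)%N ->
    index (f (nth a vs i)) vs = nth 0%N [:: 4; 4; 3; 4; 5; 6]%N i.
  case: i => [|[|[|[|[|[|//]]]]]] _.
  - by rewrite -[f _]/(f a) -fw; exact: (@idx 2).
  - by rewrite -[f _]/(f b) fb -fw; exact: (@idx 2).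
  - exact: (@idx 1).
  - exact: (@idx 2).
  - exact: (@idx 3).
  - exact: (@idx 4).
have := @signless_family R G f fE f2 a vs _ vs_uniq idxf
  (nth 0 [:: 3; 3; 0; 4; 12; 4]) erefl.
by move: qn q1 => ? ?; rewrite unlock /=; lra.
Qed.

End TwoBranches.

Section OneBranch.
Variable a : G.
Hypotheses (ac : a \notin c) (fac : f a \in c).
Hypothesis g7 : (6 < g)%N.

Let w := iter (g - 3) f (f a).
Let wc : w \in c. Proof. by rewrite iter_cycle. Qed.
Let fw : iter 3 f w = f a.
Proof.
rewrite /w -iterD addnC subnK ?(leq_trans _ g7) //.
exact: iter_size_cycle.
Qed.

(** The support is the hub f a, its child a and the cycle vertices at distance
at most 2 from the hub; w is three steps before the hub. *)
Lemma pendant_long : 4376 / 1014 <= q1.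
Proof.
pose vs := [:: a] ++ traject f w 6.
have vs_uniq : uniq vs.
  by apply: branch_uniq => //=; rewrite ?ac //; exact: ltnW.
have idx j : (j < 7)%N -> index (iter j f w) vs = j.+1.
  move=> j7; rewrite /vs branch_index ?(ltnW g7) //= ?ac //.
  by rewrite g7 andbT orbC -leq_eqVlt.
have idxf i : (i < size vs)%N ->
    index (f (nth a vs i)) vs = nth 0%N [:: 4; 2; 3; 4; 5; 6; 7]%N i.
  case: i => [|[|[|[|[|[|[|//]]]]]]] _.
  - by rewrite -[f _]/(f a) -fw; exact: (@idx 3).
  - exact: (@idx 1).
  - exact: (@idx 2).
  - exact: (@idx 3).
  - exact: (@idx 4).
  - exact: (@idx 5).
  - exact: (@idx 6).
have := @signless_family R G f fE f2 a vs _ vs_uniq idxf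
  (nth 0 [:: 10; 0; 5; 12; 24; 12; 5]) erefl.
by move: qn q1 => ? ?; rewrite unlock /=; lra.
Qed.

(** The edge from a second generation b to a improves the previous quotient
although b has weight 0. *)
Lemma branch_long b : b \notin c -> f b = a -> 4476 / 1014 <= q1.
Proof.
move=> bc fb; pose vs := [:: b; a] ++ traject f w 6.
have Lc : all [predC c] [:: b; a] by rewrite /= bc ac.
have vs_uniq : uniq vs.
  apply: branch_uniq => //; first exact: ltnW.
  by rewrite /= inE -fb eq_sym (f_neq fE).
have idx j : (j < 7)%N -> index (iter j f w) vs = j.+2.
  move=> j7; rewrite /vs branch_index ?(ltnW g7) //.
  by rewrite g7 andbT orbC -leq_eqVlt.
have idxf i : (i < size vs)%N ->
    index (f (nth a vs i)) vs = nth 0%N [:: 1; 5; 3; 4; 5; 6; 7; 8]%N i.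
  case: i => [|[|[|[|[|[|[|[|//]]]]]]]] _.
  - rewrite -[f _]/(f b) fb.
    by have := index_uniq a (isT : (1 < size vs)%N) vs_uniq.
  - by rewrite -[f _]/(f a) -fw; exact: (@idx 3).
  - exact: (@idx 1).
  - exact: (@idx 2).
  - exact: (@idx 3).
  - exact: (@idx 4).
  - exact: (@idx 5).
  - exact: (@idx 6).
have := @signless_family R G f fE f2 a vs _ vs_uniq idxf
  (nth 0 [:: 0; 10; 0; 5; 12; 24; 12; 5]) erefl.
by move: qn q1 => ? ?; rewrite unlock /=; lra.
Qed.

End OneBranch.

End BranchVectors.

(** * Comparison of the bounds in every case *)

(** For goals in which only numerals occur. The inequalities of the context are
dropped, since comparing the eigenvalues in them with each other is costly. *)
Ltac closed_lra :=
  repeat match goal with H : is_true (_ <= _)%R |- _ => clear H end; lra.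

Section Cases.
Variables (R : realType) (G : sgraph) (c : seq G).
Hypothesis hG : connected_unicyclic G.
Hypothesis hc : is_cycle c.

Local Notation f := (parent hG hc).
Local Notation lev := (level hG hc).
Local Notation g := (size c).
Local Notation h := (max_tree_diam c).
Local Notation lambda1 := (eig_max (adj_mx R G)).
Local Notation q1 := (eig_max (signless_laplacian R G)).
Local Notation qn := (eig_min (signless_laplacian R G)).

Let fE := adj_parentE hG hc.
Let f2 := parent_parent hG hc.
Let G_gt0 : (0 < #|G|)%N. Proof. by have [[]] := hG. Qed.

Hypothesis g_odd : odd g.
Hypothesis hyp : least_eigenvalue_bound R c.

Let gap nu q0 : q0 <= q1 -> 0 <= nu < 1 ->
  4 * (1 + nu) + nu * (1 - nu) <= q0 * (1 - nu) -> nu <= q1 - 2 * lambda1.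
Proof. by move=> q01 nu01; exact: spectral_gap. Qed.

Let girth : [\/ g = 3, g = 5 | 6 < g]%N.
Proof.
have : (2 < g)%N by case/andP: hc.
by move: g_odd; case: g => [|[|[|[|[|[|[|k]]]]]]] //; constructor.
Qed.

(** In the orbit of a vertex at depth p the weights approximate, up to a
factor, the extreme eigenvector of the cycle with a pendant path of length p:
its signless Laplacian for q1, its edge form for qn. Edge weights start at the
leaf, vertex weights start at the vertex of level 1. *)
Section TriangleOrbits.
Hypothesis g3 : g = 3%N.
Variable t : G.

Lemma qn_triangle_depth1 : (1 <= lev t)%N -> qn <= 18 / 41.
Proof.
move=> pt.
apply: (qn_orbit pt (y := nth 0 [:: -5; 4; -5; 4])) => [|q].
  by rewrite g3.
by rewrite unlock /=; lra.
Qed.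

Lemma qn_triangle_depth2 : (2 <= lev t)%N -> qn <= 151 / 673.
Proof.
move=> pt.
apply: (qn_orbit pt (y := nth 0 [:: -13; 23; -14; 16; -14])) => [|q].
  by rewrite g3.
by rewrite unlock /=; lra.
Qed.

Lemma qn_triangle_depth3 : (3 <= lev t)%N -> qn <= 30 / 221.
Proof.
move=> pt.
apply: (qn_orbit pt (y := nth 0 [:: -4; 7; -9; 5; -5; 5])) => [|q].
  by rewrite g3.
by rewrite unlock /=; lra.
Qed.

Lemma qn_triangle_depth4 : (4 <= lev t)%N -> qn <= 46 / 517.
Proof.
move=> pt.
apply: (qn_orbit pt (y := nth 0 [:: -4; 8; -11; 13; -7; 7; -7])) => [|q].
  by rewrite g3.
by rewrite unlock /=; lra.
Qed.

Lemma qn_triangle_depth6 : (6 <= lev t)%N -> qn <= 9 / 188.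
Proof.
move=> pt.
apply: (qn_orbit pt (y := nth 0 [:: 2; -4; 6; -8; 9; -10; 5; -5; 5])) => [|q].
  by rewrite g3.
by rewrite unlock /=; lra.
Qed.

Lemma q1_triangle : (1 <= lev t)%N -> 260 / 57 <= q1.
Proof.
move=> pt.
apply: (q1_orbit pt (z := nth 0 [:: 3; 11; 7; 7]) (n := 4)) => [|//|q].
  by rewrite g3.
by rewrite unlock /=; lra.
Qed.

End TriangleOrbits.

Section PentagonOrbits.
Hypothesis g5 : g = 5%N.
Variable t : G.

Lemma qn_pentagon_depth1 : (1 <= lev t)%N -> qn <= 47 / 193.
Proof.
move=> pt.
apply: (qn_orbit pt (y := nth 0 [:: 9; -8; 13; -15; 13; -8])) => [|q].
  by rewrite g5.
by rewrite unlock /=; lra.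
Qed.

Lemma qn_pentagon_depth2 : (2 <= lev t)%N -> qn <= 80 / 517.
Proof.
move=> pt.
apply: (qn_orbit pt (y := nth 0 [:: -6; 11; -7; 9; -10; 9; -7])) => [|q].
  by rewrite g5.
by rewrite unlock /=; lra.
Qed.

Lemma qn_pentagon_depth3 : (3 <= lev t)%N -> qn <= 5 / 48.
Proof.
move=> pt.
apply: (qn_orbit pt (y := nth 0 [:: -4; 7; -10; 6; -7; 7; -7; 6])) => [|q].
  by rewrite g5.
by rewrite unlock /=; lra.
Qed.

Lemma qn_pentagon_depth4 : (4 <= lev t)%N -> qn <= 17 / 233.
Proof.
move=> pt.
apply: (qn_orbit pt (y := nth 0 [:: 3; -6; 9; -11; 6; -7; 7; -7; 6])) => [|q].
  by rewrite g5.
by rewrite unlock /=; lra.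
Qed.

Lemma qn_pentagon_depth6 : (6 <= lev t)%N -> qn <= 8 / 189.
Proof.
move=> pt.
apply: (qn_orbit pt
  (y := nth 0 [:: -3; 5; -8; 10; -12; 13; -7; 7; -7; 7; -7])) => [|q].
  by rewrite g5.
by rewrite unlock /=; lra.
Qed.

Lemma q1_pentagon : (1 <= lev t)%N -> 679 / 153 <= q1.
Proof.
move=> pt.
apply: (q1_orbit pt (z := nth 0 [:: 5; 17; 10; 7; 7; 10]) (n := 6)) => [|//|q].
  by rewrite g5.
by rewrite unlock /=; lra.
Qed.

End PentagonOrbits.

(** The root carries two branches, so it has degree at least 4 and q1 is large;
the diameter of the tree is at most 2 p. *)
Lemma two_branch_case p t t' : lev t = p -> (0 < p)%N -> (h <= 2 * p)%N ->
  t' \notin c -> f t' = root_of hG hc t -> t' != iter p.-1 f t ->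
  spread R G <= q1 - qn.
Proof.
move=> lt p0 hp t'c ft' ne; set t1 := iter p.-1 f t in ne.
have ft1 : f t1 = root_of hG hc t by rewrite /root_of lt /t1 -iterS prednK.
have t1c : t1 \notin c.
  rewrite -(level_eq0 hG hc) /t1 level_iter lt ?leq_pred //.
  by move: p0; clear; lia.
have rc : f t1 \in c by rewrite ft1 root_of_cycle.
have ftt : f t' = f t1 by rewrite ft1.
have nett : t1 != t' by rewrite eq_sym.
case: girth => gE.
- have [U1 Q1] := twin_triangle R t1c t'c nett rc gE ftt.
  have nu_le : 129 / 1000 <= q1 - 2 * lambda1 by apply: (gap Q1); closed_lra.
  have [p1|[p2|[p3|p4]]] : (p = 1 \/ p = 2 \/ p = 3 \/ 4 <= p)%N.
    by move: p0; clear; lia.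
  + apply: (spread_by_diameter hc (D := 5) hyp nu_le U1);
      [by move: hp p1 gE; clear; lia|closed_lra].
  + have U2 := qn_triangle_depth2 gE (t := t) (eq_leq (esym (etrans lt p2))).
    apply: (spread_by_diameter hc (D := 7) hyp nu_le U2);
      [by move: hp p2 gE; clear; lia|closed_lra].
  + have U3 := qn_triangle_depth3 gE (t := t) (eq_leq (esym (etrans lt p3))).
    apply: (spread_by_diameter hc (D := 9) hyp nu_le U3);
      [by move: hp p3 gE; clear; lia|closed_lra].
  + have U4 := qn_triangle_depth4 gE (t := t) (leq_trans p4 (eq_leq (esym lt))).
    by apply: (spread_by_gap hyp nu_le U4); closed_lra.
- have Q1 : 994 / 194 <= q1 by apply: twin_long nett rc _ ftt; rewrite ?gE.
  have nu_le : 111 / 1000 <= q1 - 2 * lambda1 by apply: (gap Q1); closed_lra.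
  have [p1|[p2|p3]] : (p = 1 \/ p = 2 \/ 3 <= p)%N.
    by move: p0; clear; lia.
  + have U1 := qn_pentagon_depth1 gE (t := t) (leq_trans p0 (eq_leq (esym lt))).
    apply: (spread_by_diameter hc (D := 6) hyp nu_le U1);
      [by move: hp p1 gE; clear; lia|closed_lra].
  + have U2 := qn_pentagon_depth2 gE (t := t) (eq_leq (esym (etrans lt p2))).
    apply: (spread_by_diameter hc (D := 8) hyp nu_le U2);
      [by move: hp p2 gE; clear; lia|closed_lra].
  + have U3 := qn_pentagon_depth3 gE (t := t) (leq_trans p3 (eq_leq (esym lt))).
    by apply: (spread_by_gap hyp nu_le U3); closed_lra.
- have Q1 : 994 / 194 <= q1.
    by apply: twin_long nett rc _ ftt; rewrite ?(ltnW (ltnW gE)).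
  have nu_le : 111 / 1000 <= q1 - 2 * lambda1 by apply: (gap Q1); closed_lra.
  have pt : (0 < p <= lev t)%N by rewrite p0 lt leqnn.
  have [[p8 g8]|[[p9 g9]|n10]] :
      (p = 1 /\ g = 7 \/ p = 2 /\ g = 7 \/ 10 <= p + g)%N.
    by move: g_odd p0 gE; clear; lia.
  + have U1 : qn <= 10 / 65.
      by apply: (qn_path pt (n := 8)); [rewrite p8 g8|closed_lra].
    apply: (spread_by_diameter hc (D := 7) hyp nu_le U1);
      [by move: hp p8 g8; clear; lia|closed_lra].
  + have U1 : qn <= 10 / 82.
      by apply: (qn_path pt (n := 9)); [rewrite p9 g9|closed_lra].
    apply: (spread_by_diameter hc (D := 9) hyp nu_le U1);
      [by move: hp p9 g9; clear; lia|closed_lra].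
  + have U1 : qn <= 10 / 101.
      by apply: (qn_path pt (n := 10) n10); closed_lra.
    by apply: (spread_by_gap hyp nu_le U1); closed_lra.
Qed.

Lemma triangle_next u v : g = 3%N -> u \in c -> v \in c -> v != u ->
  v = f u \/ u = f v.
Proof.
move=> g3 uc vc vu; have f3 : f (f (f u)) = u.
  by have := iter_size_cycle hG hc uc; rewrite g3.
have := mem_cycle_traject hG hc uc v; rewrite vc g3 /= !inE (negPf vu) /=.
by case/esym/orP => /eqP->; [left|right; rewrite f3].
Qed.

(** The only vertex t off the cycle, followed by the cycle, lists all the
vertices. *)
Lemma only_pendant_family t L (w : nat -> R) n : lev t = 1%N -> n = g.+1 ->
  (forall v, v \notin c -> v = t) ->
  (forall i, (i < n)%N -> 0 < w i) ->
  (forall k, (k < n)%N -> w (if k == n.-1 then 1 else k.+1)%N +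
     \sum_(0 <= i < n | (if i == n.-1 then 1 else i.+1)%N == k) w i
       <= L * w k) ->
  lambda1 <= L.
Proof.
move=> lt nE only w0 wL.
have nE' : n = (lev t + g)%N by rewrite lt nE.
apply: (@lambda1_family R G f fE f2 G_gt0 t (traject f t n)
  (fun i => if i == n.-1 then 1 else i.+1)%N w L); rewrite ?size_traject //.
- by rewrite nE'; exact: orbit_traject_uniq.
- move=> v; rewrite nE' lt add1n /= inE.
  have [vc|/only->] := boolP (v \in c); last by rewrite eqxx.
  have rc := root_of_cycle hG hc t; rewrite /root_of lt /= in rc.
  by rewrite -(mem_cycle_traject hG hc rc) vc orbT.
- by move=> i ni; rewrite -lt; rewrite nE' in ni *; exact: orbit_index.
Qed.

(** When t is the only vertex off a triangle or a pentagon, the general lower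
bound on q1 - 2 lambda1 is too weak and lambda1 is bounded directly. Otherwise
there is a second vertex b at level 1, under another root, since the tree at
f t has no further vertex. *)
Lemma one_pendant_case t : lev t = 1%N -> (h <= 1)%N ->
  (forall v, v \notin c -> f v = f t -> v = t) ->
  (forall v, root_of hG hc v = f t -> (lev v <= 1)%N) ->
  spread R G <= q1 - qn.
Proof.
move=> lt h1 one deep; have t1 : (1 <= lev t)%N by rewrite lt.
have tc : t \notin c by rewrite -(level_eq0 hG hc) lt.
have rc : f t \in c.
  by have := root_of_cycle hG hc t; rewrite /root_of lt.
have [g7|g7] := ltnP 6 g.
  have Q1 := pendant_long R tc rc g7.
  have nu_le : 30 / 1000 <= q1 - 2 * lambda1 by apply: (gap Q1); closed_lra.
  have path n U : (1 < n <= 1 + g)%N -> 10 <= U * (n%:R ^+ 2 + 1) -> qn <= U.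
    by apply: (@qn_path R G c hG hc n t 1); rewrite lt.
  have : (g = 7 \/ g = 9 \/ 11 <= g <= 17 \/ 19 <= g)%N.
    by move: g_odd g7; clear; lia.
  case=> [e|[e|[e|e]]].
  + have U1 : qn <= 10 / 65 by apply: (path 8%N); [rewrite e|closed_lra].
    apply: (spread_by_diameter hc (D := 6) hyp nu_le U1);
      [by move: h1 e; clear; lia|closed_lra].
  + have U1 : qn <= 10 / 101 by apply: (path 10%N); [rewrite e|closed_lra].
    apply: (spread_by_diameter hc (D := 7) hyp nu_le U1);
      [by move: h1 e; clear; lia|closed_lra].
  + have n12 : (1 < 12 <= 1 + g)%N by move: e; clear; lia.
    have U1 : qn <= 10 / 145 by apply: (path _ _ n12); closed_lra.
    apply: (spread_by_diameter hc (D := 11) hyp nu_le U1);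
      [by move: h1 e; clear; lia|closed_lra].
  + have n20 : (1 < 20 <= 1 + g)%N by move: e; clear; lia.
    have U1 : qn <= 10 / 401 by apply: (path _ _ n20); closed_lra.
    by apply: (spread_by_gap hyp nu_le U1); closed_lra.
case: (pickP (fun v => (v \notin c) && (v != t))) => [v /andP[vc vt]|only].
  pose b := iter (lev v).-1 f v.
  have lv : (0 < lev v)%N by rewrite lt0n (level_eq0 hG hc).
  have fb : f b = root_of hG hc v by rewrite /b -iterS prednK.
  have lb : lev b = 1%N.
    by rewrite /b level_iter ?leq_pred //; move: lv; clear; lia.
  have bc : b \notin c by rewrite -(level_eq0 hG hc) lb.
  have fbc : f b \in c by rewrite fb root_of_cycle.
  have fbt : f b != f t.
    apply: contraNneq vt => e; apply/eqP; apply: one => //; rewrite -e fb.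
    have := deep v; rewrite -fb => /(_ e) l1.
    have lv1 : lev v = 1%N by apply/eqP; rewrite eqn_leq l1 lv.
    by rewrite /b lv1.
  have tb : t != b by apply: contraNneq fbt => ->.
  case: girth => gE.
  + have [U1 Q1] : qn <= 13 / 34 /\ 59 / 12 <= q1.
      case: (triangle_next gE rc fbc fbt) => e.
        exact: (bull_triangle R tc bc tb rc gE e).
      by rewrite eq_sym in tb; exact: (bull_triangle R bc tc tb fbc gE e).
    have nu_le : 92 / 1000 <= q1 - 2 * lambda1 by apply: (gap Q1); closed_lra.
    apply: (spread_by_diameter hc (D := 4) hyp nu_le U1);
      [by move: h1 gE; clear; lia|closed_lra].
  + have Q1 := two_pendants_pentagon R tc bc tb rc gE fbc.
    have U1 := qn_pentagon_depth1 gE t1.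
    have nu_le : 535 / 10000 <= q1 - 2 * lambda1 by apply: (gap Q1); closed_lra.
    apply: (spread_by_diameter hc (D := 5) hyp nu_le U1);
      [by move: h1 gE; clear; lia|closed_lra].
  + by exfalso; move: gE g7; clear; lia.
have {}only v : v \notin c -> v = t.
  by move=> vc; have := only v; rewrite vc => /negbFE/eqP.
case: girth => gE.
- have Q1 := q1_triangle gE t1; have U1 := qn_triangle_depth1 gE t1.
  have L1 : lambda1 <= 2205 / 1000.
    apply: (@only_pendant_family t _ (nth 0 [:: 46; 100; 83; 83]) 4 lt _ only).
    + by rewrite gE.
    + by case=> [|[|[|[|[]]]]] //= _; lra.
    + by case=> [|[|[|[|[]]]]] //= _; rewrite unlock /=; lra.
  have nu_le : 15 / 100 <= q1 - 2 * lambda1.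
    by move: Q1 L1; move: q1 lambda1 => a b *; lra.
  apply: (spread_by_diameter hc (D := 4) hyp nu_le U1);
    [by move: h1 gE; clear; lia|closed_lra].
- have Q1 := q1_pentagon gE t1; have U1 := qn_pentagon_depth1 gE t1.
  have L1 : lambda1 <= 2175 / 1000.
    apply: (@only_pendant_family t _ (nth 0 [:: 46; 100; 80; 70; 70; 80]) 6
      lt _ only).
    + by rewrite gE.
    + by case=> [|[|[|[|[|[|[]]]]]]] //= _; lra.
    + by case=> [|[|[|[|[|[|[]]]]]]] //= _; rewrite unlock /=; lra.
  have nu_le : 87 / 1000 <= q1 - 2 * lambda1.
    by move: Q1 L1; move: q1 lambda1 => a b *; lra.
  apply: (spread_by_diameter hc (D := 5) hyp nu_le U1);
    [by move: h1 gE; clear; lia|closed_lra].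
- by exfalso; move: gE g7; clear; lia.
Qed.

(** For p >= 2 and a single branch, h <= 2 p - 2. The denominator D0 + 1 then
grows like 2 p while qn decays like the square of 1 / p; once the orbit is long
enough, qn is below nu by itself. *)
Lemma one_branch_case p t : lev t = p -> (1 < p)%N -> (h <= 2 * p - 2)%N ->
  spread R G <= q1 - qn.
Proof.
move=> lt p2 hp; have p1 : (0 < p)%N := ltnW p2.
have le_lev m : (m <= p)%N -> (m <= lev t)%N by rewrite lt.
case: girth => gE.
- have Q1 := q1_triangle gE (le_lev _ p1).
  have nu_le : 55 / 1000 <= q1 - 2 * lambda1 by apply: (gap Q1); closed_lra.
  have [e|[e|[e|e]]] : (p = 2 \/ p = 3 \/ 4 <= p <= 5 \/ 6 <= p)%N.
    by move: p2; clear; lia.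
  + have U1 := qn_triangle_depth2 gE (le_lev _ p2).
    apply: (spread_by_diameter hc (D := 5) hyp nu_le U1);
      [by move: hp p2 gE e; clear; lia|closed_lra].
  + have U1 := qn_triangle_depth3 gE (le_lev _ (eq_leq (esym e))).
    apply: (spread_by_diameter hc (D := 7) hyp nu_le U1);
      [by move: hp p2 gE e; clear; lia|closed_lra].
  + have U1 := qn_triangle_depth4 gE (le_lev _ (proj1 (andP e))).
    apply: (spread_by_diameter hc (D := 11) hyp nu_le U1);
      [by move: hp p2 gE e; clear; lia|closed_lra].
  + have U1 := qn_triangle_depth6 gE (le_lev _ e).
    by apply: (spread_by_gap hyp nu_le U1); closed_lra.
- have Q1 := q1_pentagon gE (le_lev _ p1).
  have nu_le : 45 / 1000 <= q1 - 2 * lambda1 by apply: (gap Q1); closed_lra.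
  have [e|[e|[e|e]]] : (p = 2 \/ p = 3 \/ 4 <= p <= 5 \/ 6 <= p)%N.
    by move: p2; clear; lia.
  + have U1 := qn_pentagon_depth2 gE (le_lev _ p2).
    apply: (spread_by_diameter hc (D := 6) hyp nu_le U1);
      [by move: hp p2 gE e; clear; lia|closed_lra].
  + have U1 := qn_pentagon_depth3 gE (le_lev _ (eq_leq (esym e))).
    apply: (spread_by_diameter hc (D := 8) hyp nu_le U1);
      [by move: hp p2 gE e; clear; lia|closed_lra].
  + have U1 := qn_pentagon_depth4 gE (le_lev _ (proj1 (andP e))).
    apply: (spread_by_diameter hc (D := 12) hyp nu_le U1);
      [by move: hp p2 gE e; clear; lia|closed_lra].
  + have U1 := qn_pentagon_depth6 gE (le_lev _ e).
    by apply: (spread_by_gap hyp nu_le U1); closed_lra.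
- have Q1 : 4476 / 1014 <= q1.
    pose a := iter p.-1 f t; pose b := iter p.-2 f t.
    have fb : f b = a by rewrite /a /b -iterS prednK //; move: p2; clear; lia.
    have lx k : (k < p)%N -> iter k f t \notin c.
      move=> kp; rewrite -(level_eq0 hG hc) level_iter lt ?(ltnW kp) //.
      by move: kp; clear; lia.
    have ac : a \notin c by apply: lx; move: p2; clear; lia.
    have bc : b \notin c by apply: lx; move: p2; clear; lia.
    have fac : f a \in c.
      by rewrite /a -iterS prednK // -lt; exact: root_of_cycle.
    exact: (branch_long R ac fac gE bc fb).
  have nu_le : 43 / 1000 <= q1 - 2 * lambda1 by apply: (gap Q1); closed_lra.
  have pt : (0 < p <= lev t)%N by rewrite p1 lt leqnn.
  have path n U : (1 < n <= p + g)%N -> 10 <= U * (n%:R ^+ 2 + 1) -> qn <= U.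
    exact: (@qn_path R G c hG hc n t p U pt).
  have : (p + g = 9 \/ p + g = 10 \/ p + g = 11 \/ p + g = 12 \/ p + g = 13
      \/ 14 <= p + g <= 15 \/ 16 <= p + g)%N by move: p2 gE; clear; lia.
  case=> [e|[e|[e|[e|[e|[e|e]]]]]].
  + have U1 : qn <= 10 / 82 by apply: (path 9%N); [rewrite e|closed_lra].
    apply: (spread_by_diameter hc (D := 7) hyp nu_le U1);
      [by move: hp p2 gE e; clear; lia|closed_lra].
  + have U1 : qn <= 10 / 101 by apply: (path 10%N); [rewrite e|closed_lra].
    apply: (spread_by_diameter hc (D := 9) hyp nu_le U1);
      [by move: hp p2 gE e; clear; lia|closed_lra].
  + have U1 : qn <= 10 / 122 by apply: (path 11%N); [rewrite e|closed_lra].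
    apply: (spread_by_diameter hc (D := 11) hyp nu_le U1);
      [by move: hp p2 gE e; clear; lia|closed_lra].
  + have U1 : qn <= 10 / 145 by apply: (path 12%N); [rewrite e|closed_lra].
    apply: (spread_by_diameter hc (D := 13) hyp nu_le U1);
      [by move: hp p2 gE e; clear; lia|closed_lra].
  + have U1 : qn <= 10 / 170 by apply: (path 13%N); [rewrite e|closed_lra].
    apply: (spread_by_diameter hc (D := 15) hyp nu_le U1);
      [by move: hp p2 gE e; clear; lia|closed_lra].
  + have n14 : (1 < 14 <= p + g)%N by case/andP: e.
    have U1 : qn <= 10 / 197 by apply: (path _ _ n14); closed_lra.
    apply: (spread_by_diameter hc (D := 19) hyp nu_le U1);
      [by move: hp p2 gE e; clear; lia|closed_lra].
  + have U1 : qn <= 10 / 257 by apply: (path 16%N _ e); closed_lra.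
    by apply: (spread_by_gap hyp nu_le U1); closed_lra.
Qed.

End Cases.

(** * The cycle itself, and the theorem *)

Section CycleGraph.
Variables (R : realType) (G : sgraph) (c : seq G).
Hypothesis hG : connected_unicyclic G.
Hypothesis hc : is_cycle c.

Let G_gt0 : (0 < #|G|)%N. Proof. by have [[]] := hG. Qed.
Let c_uniq : uniq c. Proof. by case/andP: hc => /andP[]. Qed.

(** Every degree is 2, so Q = A + 2 I. *)
Lemma cycle_spread : (forall v, v \in c) -> signless_spread R G = spread R G.
Proof.
move=> cT.
have deg2 (v : G) : degree v = 2%N.
  rewrite (degreeE (adj_parentE hG hc) (parent_parent hG hc)).
  have -> : [set x | parent hG hc x == v] = [set prev c v].
    apply/setP => x; rewrite !inE parent_cycle ?cT //.
    by apply/eqP/eqP => [<-|->]; rewrite ?prev_next ?next_prev.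
  by rewrite cards1.
have QE : signless_laplacian R G = adj_mx R G + 2%:M.
  rewrite addrC /signless_laplacian; congr (_ + _).
  by apply/matrixP => i j; rewrite !mxE deg2.
have symA : (adj_mx R G)^T = adj_mx R G.
  by apply/matrixP => i j; rewrite !mxE adj_sym.
have symQ : (signless_laplacian R G)^T = signless_laplacian R G.
  by rewrite QE linearD /= symA tr_scalar_mx.
have [] := @eig_shift R _ _ _ (signless_laplacian R G) 2 G_gt0 G_gt0 symA symQ.
  move=> a; rewrite QE /eigenvalue /eigenspace; congr (kermx _ != 0).
  by apply/matrixP => i j; rewrite !mxE; case: (i == j); ring.
by rewrite /signless_spread /spread => -> ->; ring.
Qed.

End CycleGraph.

Theorem corollary12 (R : realType) (G : sgraph) (hG : connected_unicyclic G)
    (c : seq G) (hc : is_cycle c) (hodd : odd (size c)) :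
  let g := size c in
  let h := max_tree_diam c in
  let lambda1 := eig_max (adj_mx R G) in
  let lambdan := eig_min (adj_mx R G) in
  let D0 : R := (g%:R + 1) / 2 + h%:R in
  let q1 := eig_max (signless_laplacian R G) in
  let qn := eig_min (signless_laplacian R G) in
  lambdan >= 1 - cos (pi / (D0 + 1)) - lambda1 ->
  spread R (line_graph G) = q1 - qn /\
  q1 - qn = signless_spread R G /\
  signless_spread R G >= spread R G.
Proof.
move=> g h lambda1 lambdan D0 q1 qn hyp.
have fE := adj_parentE hG hc; have f2 := parent_parent hG hc.
have G_gt0 : (0 < #|G|)%N by have [[]] := hG.
split; first exact: line_spread fE f2 G_gt0.
split; first by [].
case: (pickP (fun v => v \notin c)) => [v vc|allc]; last first.
  by rewrite (@cycle_spread R G c hG hc) // => v; have := allc v => /negbFE.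
have [t [t0 tmax [hp [[t' [t'c ft' ne]]|[one hp1]]]]] := deep_branch hG hc vc.
  exact: (two_branch_case hodd hyp erefl t0 hp t'c ft' ne).
have [t2|t1] := ltnP 1 (level hG hc t).
  apply: (one_branch_case hodd hyp erefl t2).
  by apply: leq_trans hp1 _; move: t2; clear; lia.
have lt : level hG hc t = 1%N by apply/eqP; rewrite eqn_leq t1 t0.
rewrite /root_of lt /= in one hp1 tmax.
exact: (one_pendant_case hodd hyp lt hp1 one tmax).
Qed.
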